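(* Let $\mathbb{K}=\mathbb{R}$ or $\mathbb{C}$, let $x=(x_1,\dots,x_n)$, and let $I=(F_1,\dots,F_k)$ be a complete intersection ideal in $\mathbb{K}\{x\}$ with $\dim\mathbb{K}\{x\}/I=n-k$. Then there exists $\mu_0\in\mathbb{N}$ such that for every $\mu\geq\mu_0$ and for any $G_1,\dots,G_k\in\mathbb{K}\{x\}$ satisfying $j^\mu G_i=j^\mu F_i$ for $1\leq i\leq k$, the ideal $I_\mu:=(G_1,\dots,G_k)$ is a complete intersection ideal in $\mathbb{K}\{x\}$ and $H_{I_\mu}=H_I$.
   Context: $\mathbb{K}\{x\}$ is the ring of convergent power series in $x=(x_1,\dots,x_n)$ over $\mathbb{K}$, with maximal ideal $\mathfrak{m}$. An ideal $J$ in a regular local ring $A$ is called a complete intersection when $J$ can be generated by $\dim A-\dim A/J$ elements. For $F\in\mathbb{K}\{x\}$ and $\mu\in\mathbb{N}$, the $\mu$-jet $j^\mu F$ is the image of $F$ in $\mathbb{K}\{x\}/\mathfrak{m}^{\mu+1}$. For an ideal $J$ in $\mathbb{K}\{x\}$, the Hilbert-Samuel function $H_J$ of $\mathbb{K}\{x\}/J$ is $H_J(\eta)=\dim_{\mathbb{K}}\mathbb{K}\{x\}/(J+\mathfrak{m}^{\eta+1})$ for $\eta\in\mathbb{N}$. *)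

(* Defs.v *)
From HB Require Import structures.
From mathcomp Require Import all_boot all_order all_algebra.
From mathcomp Require Import generic_quotient ring_quotient.
From mathcomp Require Import boolp classical_sets reals complex mpoly.

Set Implicit Arguments.
Unset Strict Implicit.
Unset Printing Implicit Defensive.
Import Order.TTheory GRing.Theory Num.Theory.
Local Open Scope ring_scope.
Local Open Scope quotient_scope.
Local Open Scope classical_set_scope.

(* The [idealr] of ring_quotient excludes the unit ideal, hence this record. *)
Record ideal (A : comPzRingType) := Ideal {
  ideal_set :> A -> Prop;
  ideal0 : ideal_set 0;
  idealD : forall u v, ideal_set u -> ideal_set v -> ideal_set (u + v);
  idealM : forall a u, ideal_set u -> ideal_set (a * u) }.

Definition ideal_mem (A : comPzRingType) (J : ideal A) : A -> bool :=
  fun u => `[< J u >].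

Section IdealQuotient.
Variables (A : comPzRingType) (J : ideal A).

Lemma ideal_memP u : reflect (J u) (u \in (ideal_mem J : {pred A})).
Proof. exact: asboolP. Qed.

Lemma ideal_mem_zmod_closed : zmod_closed (ideal_mem J : {pred A}).
Proof.
split=> [|u v /ideal_memP Ju /ideal_memP Jv]; apply/ideal_memP.
  exact: ideal0.
by apply: idealD => //; rewrite -mulN1r; apply: idealM.
Qed.

HB.instance Definition _ :=
  GRing.isZmodClosed.Build A (ideal_mem J) ideal_mem_zmod_closed.

Definition ideal_zmod : zmodClosed A :=
  GRing.ZmodClosed.clone A (ideal_mem J) _.

Definition quot_ring : Type := {ideal_quot ideal_zmod}.

HB.instance Definition _ := GRing.Zmodule.on quot_ring.
HB.instance Definition _ : EqQuotient A (Quotient.equiv ideal_zmod) quot_ring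
  := EqQuotient.on quot_ring.
HB.instance Definition _ := ZmodQuotient.on quot_ring.

Lemma quot_eqP u v :
  reflect (J (u - v)) (\pi_quot_ring u == \pi_quot_ring v).
Proof. by rewrite piE /Quotient.equiv; apply: ideal_memP. Qed.

Lemma quot_piD u v : \pi_quot_ring (u + v) = \pi_quot_ring u + \pi_quot_ring v.
Proof. by rewrite !piE. Qed.

Definition quot_one : quot_ring := \pi_quot_ring 1.
Definition quot_mul (u v : quot_ring) : quot_ring :=
  \pi_quot_ring (repr u * repr v).

Lemma quot_piM u v :
  \pi_quot_ring (u * v) = quot_mul (\pi_quot_ring u) (\pi_quot_ring v).
Proof.
apply/eqP/quot_eqP; set u' := repr _; set v' := repr _.
have -> : u * v - u' * v' = v * (u - u') + u' * (v - v').
  by rewrite mulrBr (mulrC v) (mulrC v u') mulrBr addrA subrK.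
by apply: idealD; apply: idealM; apply/quot_eqP; rewrite reprK.
Qed.

Lemma quot_mulA : associative quot_mul.
Proof.
elim/quotW=> u; elim/quotW=> v; elim/quotW=> w.
by rewrite -(quot_piM v w) -(quot_piM u v) -!quot_piM mulrA.
Qed.

Lemma quot_mulC : commutative quot_mul.
Proof. by elim/quotW=> u; elim/quotW=> v; rewrite -!quot_piM mulrC. Qed.

Lemma quot_mul1 : left_id quot_one quot_mul.
Proof. by elim/quotW=> u; rewrite -quot_piM mul1r. Qed.

Lemma quot_mulD : left_distributive quot_mul +%R.
Proof.
elim/quotW=> u; elim/quotW=> v; elim/quotW=> w.
by rewrite -(quot_piD u v) -!quot_piM -quot_piD mulrDl.
Qed.

HB.instance Definition _ := GRing.Zmodule_isComPzRing.Build quot_ring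
  quot_mulA quot_mulC quot_mul1 quot_mulD.

End IdealQuotient.

Section QuotientModule.
Variables (K : comNzRingType) (A : comAlgType K) (J : ideal A).

Definition quot_scale (c : K) (u : quot_ring J) : quot_ring J :=
  \pi_(quot_ring J) (c *: repr u).

Lemma quot_piZ c u :
  \pi_(quot_ring J) (c *: u) = quot_scale c (\pi_(quot_ring J) u).
Proof.
apply/eqP/quot_eqP; rewrite -scalerBr -mulr_algl; apply: idealM.
by apply/quot_eqP; rewrite reprK.
Qed.

Lemma quot_scaleA a b u : quot_scale a (quot_scale b u) = quot_scale (a * b) u.
Proof. by elim/quotW: u => u; rewrite -(quot_piZ b u) -!quot_piZ scalerA. Qed.

Lemma quot_scale1 : left_id 1 quot_scale.
Proof. by elim/quotW=> u; rewrite -quot_piZ scale1r. Qed.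

Lemma quot_scaleDr : right_distributive quot_scale +%R.
Proof.
move=> a; elim/quotW=> u; elim/quotW=> v.
by rewrite -(quot_piD J u v) -!quot_piZ -quot_piD scalerDr.
Qed.

Lemma quot_scaleDl u : {morph quot_scale^~ u : a b / a + b}.
Proof.
by move=> a b; elim/quotW: u => u; rewrite -!quot_piZ -quot_piD scalerDl.
Qed.

HB.instance Definition _ := GRing.Zmodule_isLmodule.Build K (quot_ring J)
  quot_scaleA quot_scale1 quot_scaleDr quot_scaleDl.

End QuotientModule.

Section IdealOperations.
Variable A : comPzRingType.
Implicit Types (J I : ideal A) (S : set A).

Section Span.
Variable S : set A.

Definition span_set : set A := [set u | exists r (a s : 'I_r -> A),
  (forall i, S (s i)) /\ u = \sum_(i < r) a i * s i].

Lemma span_set0 : span_set 0.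
Proof.
exists 0%N, (fun=> 0), (fun=> 0); split; first by case.
by rewrite big_ord0.
Qed.

Lemma span_setD u v : span_set u -> span_set v -> span_set (u + v).
Proof.
move=> [p [a [s [Ss ->]]]] [q [b [t [St ->]]]].
pose glue (f : 'I_p -> A) (g : 'I_q -> A) (i : 'I_(p + q)) :=
  match split i with inl j => f j | inr j => g j end.
exists (p + q)%N, (glue a b), (glue s t); split.
  by move=> i; rewrite /glue; case: (split i).
rewrite big_split_ord /=; congr (_ + _); apply: eq_bigr => i _; rewrite /glue.
  by rewrite -[lshift q i]/(unsplit (inl i)) unsplitK.
by rewrite -[rshift p i]/(unsplit (inr i)) unsplitK.
Qed.

Lemma span_setM a u : span_set u -> span_set (a * u).
Proof.
move=> [p [b [s [Ss ->]]]]; exists p, (fun i => a * b i), s; split=> //.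
by rewrite mulr_sumr; apply: eq_bigr => i _; rewrite mulrA.
Qed.

Definition ideal_span : ideal A := Ideal span_set0 span_setD span_setM.

End Span.

Section Sum.
Variables J I : ideal A.

Definition ideal_add_set : set A :=
  [set u | exists v w, [/\ J v, I w & u = v + w]].

Lemma ideal_add_set0 : ideal_add_set 0.
Proof. by exists 0, 0; split; rewrite ?addr0 //; apply: ideal0. Qed.

Lemma ideal_add_setD u v :
  ideal_add_set u -> ideal_add_set v -> ideal_add_set (u + v).
Proof.
move=> [u1 [u2 [Ju Iu ->]]] [v1 [v2 [Jv Iv ->]]].
by exists (u1 + v1), (u2 + v2); split; rewrite 1?addrACA //; apply: idealD.
Qed.

Lemma ideal_add_setM a u : ideal_add_set u -> ideal_add_set (a * u).
Proof.
move=> [u1 [u2 [Ju Iu ->]]].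
by exists (a * u1), (a * u2); split; rewrite ?mulrDr //; apply: idealM.
Qed.

Definition ideal_add : ideal A :=
  Ideal ideal_add_set0 ideal_add_setD ideal_add_setM.

End Sum.

Definition ideal_pow J (e : nat) : ideal A :=
  ideal_span [set u | exists s : 'I_e -> A,
    (forall i, J (s i)) /\ u = \prod_(i < e) s i].

Definition prime_ideal J : Prop :=
  ~ J 1 /\ forall u v, J (u * v) -> J u \/ J v.

End IdealOperations.

Definition has_prime_chain (A : comPzRingType) (d : nat) : Prop :=
  exists P : 'I_d.+1 -> ideal A, (forall i, prime_ideal (P i)) /\
    forall i j : 'I_d.+1, (i < j)%N -> ideal_set (P i) `<` ideal_set (P j).

(* A relation: the Krull dimension of the zero ring is not a natural number,
   and no [d] is related to it. *)
Definition krull_dim_is (A : comPzRingType) (d : nat) : Prop :=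
  has_prime_chain A d /\ forall e, has_prime_chain A e -> (e <= d)%N.

Definition generated_by (A : comPzRingType) (J : ideal A) (r : nat) : Prop :=
  exists g : 'I_r -> A, ideal_set J = ideal_set (ideal_span (range g)).

Definition complete_intersection (A : comPzRingType) (J : ideal A) : Prop :=
  exists d e, [/\ krull_dim_is A d, krull_dim_is (quot_ring J) e
                & generated_by J (d - e)].

(* The property underlying [Vector.axiom], for an arbitrary module. *)
Definition has_dim (K : fieldType) (V : lmodType K) (d : nat) : Prop :=
  exists f : {linear V -> 'rV[K]_d}, bijective f.

(* 0 when [V] is not finite dimensional. *)
Definition vdim (K : fieldType) (V : lmodType K) : nat :=
  xget 0%N [set d | has_dim V d].

Section FormalPowerSeries.
Variables (n : nat) (K : comNzRingType).

Definition fps : Type := 'X_{1..n} -> K.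

HB.instance Definition _ := gen_eqMixin fps.
HB.instance Definition _ := gen_choiceMixin fps.

Implicit Types f g h : fps.

Definition fps_mul f g : fps := fun a =>
  \sum_(b : 'X_{1..n < (mdeg a).+1, (mdeg a).+1} | a == (b.1 + b.2)%MM)
    f b.1 * g b.2.
Definition fps_one : fps := fun a => (a == 0%MM)%:R.

Let addA : associative (fun f g : fps => (fun a => f a + g a) : fps).
Proof. by move=> f g h; apply: funext => a; rewrite addrA. Qed.
Let addC : commutative (fun f g : fps => (fun a => f a + g a) : fps).
Proof. by move=> f g; apply: funext => a; rewrite addrC. Qed.
Let add0 :
  left_id ((fun=> 0) : fps) (fun f g : fps => (fun a => f a + g a) : fps).
Proof. by move=> f; apply: funext => a; rewrite add0r. Qed.
Let addN : left_inverse ((fun=> 0) : fps) (fun f : fps => (fun a => - f a) : fps)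
  (fun f g : fps => (fun a => f a + g a) : fps).
Proof. by move=> f; apply: funext => a; rewrite addNr. Qed.

HB.instance Definition _ := GRing.isZmodule.Build fps addA addC add0 addN.

Definition fps_trunc d f : {mpoly K[n]} :=
  \sum_(a : 'X_{1..n < d}) f a *: 'X_[a].

Lemma fps_truncE d f (a : 'X_{1..n}) : (mdeg a < d)%N ->
  (fps_trunc d f)@_a = f a.
Proof. exact: mcoeff_mpoly. Qed.

Lemma fps_mul_trunc d f g (a : 'X_{1..n}) : (mdeg a < d)%N ->
  fps_mul f g a = (fps_trunc d f * fps_trunc d g)@_a.
Proof.
move=> lt_ad; rewrite mcoeffM; apply: eq_bigr => b _.
by rewrite !fps_truncE // (leq_trans (bmdeg _)).
Qed.

Lemma fps_mulE d f g (a : 'X_{1..n}) : (mdeg a < d)%N ->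
  fps_mul f g a =
    \sum_(b : 'X_{1..n < d, d} | a == (b.1 + b.2)%MM) f b.1 * g b.2.
Proof.
move=> lt_ad; rewrite (fps_mul_trunc f g lt_ad).
rewrite [LHS](mcoeff_poly_mul _ _ lt_ad); apply: eq_bigr => b _.
by rewrite !fps_truncE // bmdeg.
Qed.

Let mulA : associative fps_mul.
Proof.
move=> f g h; apply: funext => a; have lt_a := ltnSn (mdeg a).
transitivity
  ((fps_trunc (mdeg a).+1 f * fps_trunc (mdeg a).+1 g *
    fps_trunc (mdeg a).+1 h)@_a); last first.
  rewrite mcoeffM; apply: eq_bigr => b _.
  by rewrite -(fps_mul_trunc _ _ (bmdeg _)) fps_truncE // bmdeg.
rewrite -mulrA mcoeffM; apply/esym; apply: eq_bigr => b _.
by rewrite -(fps_mul_trunc _ _ (bmdeg _)) fps_truncE // bmdeg.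
Qed.

Let mulC : commutative fps_mul.
Proof.
move=> f g; apply: funext => a.
by rewrite !(fps_mul_trunc _ _ (ltnSn _)) mulrC.
Qed.

Let mul1 : left_id fps_one fps_mul.
Proof.
move=> f; apply: funext => a; rewrite (fps_mul_trunc _ _ (ltnSn _)).
suff -> : fps_trunc (mdeg a).+1 fps_one = 1 by rewrite mul1r fps_truncE.
apply/mpolyP => b; rewrite mcoeff1.
have [lt_b|le_b] := ltnP (mdeg b) (mdeg a).+1; first by rewrite fps_truncE.
rewrite raddf_sum big1 /= => [|c _].
  by case: eqP le_b => // ->; rewrite mdeg0.
rewrite mcoeffZ mcoeffX; case: eqP => [cb|]; last by rewrite mulr0.
by have := bmdeg c; rewrite cb ltnNge le_b.
Qed.

Let mulD : left_distributive fps_mul +%R.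
Proof.
move=> f g h; apply: funext => a.
rewrite {2}/GRing.add /= /fps_mul -big_split /=; apply: eq_bigr => b _.
by rewrite -mulrDl.
Qed.

Let one_neq0 : fps_one != 0.
Proof.
apply/eqP => /(congr1 (fun f : fps => f 0%MM)) /eqP.
by rewrite /fps_one eqxx oner_eq0.
Qed.

HB.instance Definition _ :=
  GRing.Zmodule_isComNzRing.Build fps mulA mulC mul1 mulD one_neq0.

Definition fps_scale (c : K) f : fps := fun a => c * f a.

Let scaleA a b f : fps_scale a (fps_scale b f) = fps_scale (a * b) f.
Proof. by apply: funext => x; rewrite /fps_scale mulrA. Qed.
Let scale1 : left_id 1 fps_scale.
Proof. by move=> f; apply: funext => x; rewrite /fps_scale mul1r. Qed.
Let scaleDr : right_distributive fps_scale +%R.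
Proof. by move=> c f g; apply: funext => x; rewrite /fps_scale mulrDr. Qed.
Let scaleDl f : {morph fps_scale^~ f : a b / a + b}.
Proof. by move=> a b; apply: funext => x; rewrite /fps_scale mulrDl. Qed.

HB.instance Definition _ :=
  GRing.Zmodule_isLmodule.Build K fps scaleA scale1 scaleDr scaleDl.

Let scaleAl (c : K) f g : c *: (f * g) = (c *: f) * g.
Proof.
apply: funext => a; rewrite [LHS]mulr_sumr; apply: eq_bigr => b _.
by rewrite mulrA.
Qed.

HB.instance Definition _ := GRing.Lmodule_isLalgebra.Build K fps scaleAl.
HB.instance Definition _ := GRing.Lalgebra_isComAlgebra.Build K fps.

End FormalPowerSeries.

Section ConvergentPowerSeries.
Variables (n : nat) (K : numFieldType).

(* Absolute convergence on some polydisc: the partial sums of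
   sum_a |f_a| r^|a| are bounded for some r > 0. As [x <= y] in a numFieldType
   forces [y - x] to be real, [r] is a positive real also when K is complex. *)
Definition convergent (f : fps n K) : Prop := exists r M : K, 0 < r /\
  forall d, \sum_(a : 'X_{1..n < d}) `|f a| * r ^+ mdeg a <= M.

Definition convergentb : fps n K -> bool := fun f => `[< convergent f >].

Lemma convergentbP (f : fps n K) : reflect (convergent f) (f \in (convergentb : {pred _})).
Proof. exact: asboolP. Qed.

Lemma convergent_common (f g : fps n K) : convergent f -> convergent g ->
  exists r M N : K, [/\ 0 < r,
    forall d, \sum_(a : 'X_{1..n < d}) `|f a| * r ^+ mdeg a <= M &
    forall d, \sum_(a : 'X_{1..n < d}) `|g a| * r ^+ mdeg a <= N].
Proof.
move=> [r [M [r0 fM]]] [s [N [s0 gN]]].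
have sub (h : fps n K) (t t' B : K) : 0 < t' -> t' <= t ->
    (forall d, \sum_(a : 'X_{1..n < d}) `|h a| * t ^+ mdeg a <= B) ->
    forall d, \sum_(a : 'X_{1..n < d}) `|h a| * t' ^+ mdeg a <= B.
  move=> t0 tt hB d; apply: le_trans (hB d); apply: ler_sum => a _.
  by rewrite ler_wpM2l // lerXn2r ?nnegrE // ltW // (lt_le_trans t0).
have /orP[rs|sr] : (r <= s) || (s <= r).
- exact: (real_comparable (gtr0_real r0) (gtr0_real s0)).
- by exists r, M, N; split=> //; apply: sub gN.
- by exists s, M, N; split=> //; apply: sub fM.
Qed.

Lemma convergent_subalg_closed : subalg_closed (convergentb : {pred fps n K}).
Proof.
split.
- have oneE a : (1 : fps n K) a = (a == 0%MM)%:R by [].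
  apply/convergentbP; exists 1, 1; split=> // d; case: d => [|d].
    by rewrite big1 // => -[].
  rewrite (bigD1 (bm0 : 'X_{1..n < d.+1})) //= big1 ?addr0 => [|a ne_a0].
    by rewrite oneE eqxx normr1 expr1n mulr1.
  by rewrite oneE (negPf (ne_a0 : (a : 'X_{1..n}) != 0%MM)) normr0 mul0r.
- move=> c f g /convergentbP cf /convergentbP cg; apply/convergentbP.
  have [r [M [N [r0 fM gN]]]] := convergent_common cf cg.
  exists r, (`|c| * M + N); split=> // d.
  apply: le_trans (lerD (ler_wpM2l (normr_ge0 c) (fM d)) (gN d)).
  rewrite mulr_sumr -big_split /=; apply: ler_sum => a _.
  rewrite mulrA -mulrDl ler_wpM2r ?exprn_ge0 ?(ltW r0) // -normrM.
  exact: (ler_normD (c * f a) (g a)).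
- move=> f g /convergentbP cf /convergentbP cg; apply/convergentbP.
  have [r [M [N [r0 fM gN]]]] := convergent_common cf cg.
  exists r, (M * N); split=> // d.
  pose F (a : 'X_{1..n}) := `|f a| * r ^+ mdeg a.
  pose G (a : 'X_{1..n}) := `|g a| * r ^+ mdeg a.
  have F0 a : 0 <= F a by rewrite mulr_ge0 // exprn_ge0 // ltW.
  have G0 a : 0 <= G a by rewrite mulr_ge0 // exprn_ge0 // ltW.
  apply: (@le_trans _ _ (\sum_(b : 'X_{1..n < d, d}) F b.1 * G b.2)); last first.
    have -> : \sum_(b : 'X_{1..n < d, d}) F b.1 * G b.2 =
        (\sum_(b : 'X_{1..n < d}) F b) * (\sum_(b : 'X_{1..n < d}) G b).
      by rewrite big_distrlr /= pair_big.
    by apply: ler_pM => //; apply: sumr_ge0.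
  apply: (@le_trans _ _ (\sum_(a : 'X_{1..n < d})
      \sum_(b : 'X_{1..n < d, d} | (a : 'X_{1..n}) == (b.1 + b.2)%MM)
        F b.1 * G b.2)).
    apply: ler_sum => a _; rewrite [(f * g) a](fps_mulE _ _ (bmdeg a)).
    rewrite -ler_pdivlMr ?exprn_gt0 //; apply: le_trans (ler_norm_sum _ _ _) _.
    rewrite mulr_suml; apply: ler_sum => b /eqP ->.
    by rewrite mdegD exprD normrM mulrACA mulfK // mulf_neq0 ?expf_neq0 ?gt_eqF.
  rewrite (exchange_big_dep xpredT) //=; apply: ler_sum => b _.
  rewrite -big_filter; set s := filter _ _.
  have us : uniq s by rewrite filter_uniq ?index_enum_uniq.
  have ss a : a \in s -> bmnm a = (b.1 + b.2)%MM.
    by rewrite mem_filter => /andP[/eqP].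
  case: s us ss => [_ _|a [|a' s] us ss]; first by rewrite big_nil mulr_ge0.
    by rewrite big_seq1.
  have E : a = a'.
    by apply: val_inj; rewrite [LHS]ss ?[RHS]ss // !inE eqxx ?orbT.
  by move: us; rewrite /= E inE eqxx.
Qed.

HB.instance Definition _ := GRing.isSubalgClosed.Build K (fps n K) convergentb
  (GRing.subalg_closed_semi convergent_subalg_closed).

Record cps := Cps { cps_val :> fps n K; _ : cps_val \in (convergentb : {pred _}) }.

HB.instance Definition _ := [isSub for cps_val].
HB.instance Definition _ := [Choice of cps by <:].
HB.instance Definition _ := [SubChoice_isSubAlgebra of cps by <:].
HB.instance Definition _ := [SubNzRing_isSubComNzRing of cps by <:].
HB.instance Definition _ := GRing.ComAlgebra.on cps.

Definition cps_maximal_set : set cps := [set f : cps | cps_val f 0%MM = 0].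

Lemma cps_maximal_set0 : cps_maximal_set 0.
Proof. by []. Qed.

Lemma cps_maximal_setD (f g : cps) :
  cps_maximal_set f -> cps_maximal_set g -> cps_maximal_set (f + g).
Proof.
move=> f0 g0; rewrite /cps_maximal_set /=.
by rewrite [LHS](_ : _ = cps_val f 0%MM + cps_val g 0%MM) // f0 g0 addr0.
Qed.

Lemma cps_maximal_setM (f g : cps) : cps_maximal_set g -> cps_maximal_set (f * g).
Proof.
move=> g0; rewrite /cps_maximal_set /=.
rewrite [LHS](_ : _ = fps_mul (cps_val f) (cps_val g) 0%MM) // /fps_mul big1 // => -[b c] /=.
rewrite eq_sym -mdeg_eq0 mdegD addn_eq0 !mdeg_eq0 => /andP[_ /eqP ->].
by rewrite g0 mulr0.
Qed.

Definition cps_maximal : ideal cps :=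
  Ideal cps_maximal_set0 cps_maximal_setD cps_maximal_setM.

Definition jet (mu : nat) (f : cps) : quot_ring (ideal_pow cps_maximal mu.+1) :=
  \pi f.

Definition hilbert_samuel (J : ideal cps) (eta : nat) : nat :=
  vdim (quot_ring (ideal_add J (ideal_pow cps_maximal eta.+1)) : lmodType K).

End ConvergentPowerSeries.

(* Main.v *)
Require Import Defs.
From HB Require Import structures.
From mathcomp Require Import all_boot all_order all_algebra.
From mathcomp Require Import boolp classical_sets reals complex.
From mathcomp Require Import mpoly ring zify.

Set Implicit Arguments.
Unset Strict Implicit.
Unset Printing Implicit Defensive.
Import Order.TTheory GRing.Theory Num.Theory.
Local Open Scope ring_scope.
Local Open Scope classical_set_scope.
Local Open Scope quotient_scope.

(* Write [A = K{x}] and [O N] for the ideal of series of order at least [N].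

   Dividing by a standard basis of an ideal (for the degree-lexicographic order,
   with weights making all non-leading terms small) gives convergent quotients,
   whose coefficients are finite sums; hence [K] need not be complete. This
   yields at once the Artin-Rees property, the closedness and finite generation
   of all ideals of [A], and [O N = m^N].

   For generators [F_1, ..., F_k] of [I], choose [y_1, ..., y_(n-k)] such that
   [I + (y)] is [m]-primary. Since [x_1, ..., x_n] is a regular sequence, an
   exchange argument shows that so is [F_1, ..., F_k, y_1, ..., y_(n-k)]. By
   Artin-Rees, for each [j] there is a constant [c] with
     F_(j+1) b \in I_j + O N  ==>  b \in I_j + O (N - c),
   where [I_j = (F_1, ..., F_j)], and such bounds persist when the [F_i] are
   replaced by [G_i] agreeing with them to high order. Consequently [(F)] and
   [(G)] have the same initial forms, so the same Hilbert-Samuel function, and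
   [G_1, ..., G_k, y_1, ..., y_(n-k)] is again a regular sequence generating an
   [m]-primary ideal. The regular sequence [y] modulo [(G)] produces a chain of
   primes of length [n - k] above [(G)]; the growth of the Hilbert function
   shows that no chain is longer. *)

Lemma idealB (A : comPzRingType) (J : ideal A) u v : J u -> J v -> J (u - v).
Proof. by move=> Ju Jv; apply: idealD => //; rewrite -mulN1r; apply: idealM. Qed.

Lemma idealZ (K : comNzRingType) (A : comAlgType K) (J : ideal A) (c : K) u :
  J u -> J (c *: u).
Proof. by move=> Ju; rewrite -mulr_algl; apply: idealM. Qed.

Lemma ideal_sum (A : comPzRingType) (J : ideal A) (I : Type) (r : seq I) (P : pred I)
  (F : I -> A) : (forall i, P i -> J (F i)) -> J (\sum_(i <- r | P i) F i).
Proof. by move=> JF; apply: big_ind => //; [apply: ideal0 | apply: idealD]. Qed.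

(** The facts about the order filtration on which all the later algebra rests. [adic_prod] is the
    inclusion of [O (M + N)] in the product of [O M] and [O N], phrased without products of ideals;
    [artin_rees] at [N = 0] also yields finite generation. *)
Record adic_filtration (K : numFieldType) (A : comAlgType K)
    (O : nat -> ideal A) : Prop := AdicFiltration {
  adic0 : forall u, O 0%N u;
  adicS : forall N u, O N.+1 u -> O N u;
  adicM : forall M N u v, O M u -> O N v -> O (M + N)%N (u * v);
  adic_prod : forall (J : ideal A) M N,
    (forall u v, O M u -> O N v -> J (u * v)) -> forall u, O (M + N)%N u -> J u;
  adic_closed : forall (J : ideal A) u, (forall N, ideal_add J (O N) u) -> J u;
  artin_rees : forall J : ideal A, exists r (h : 'I_r -> A) c,
    (forall i, J (h i)) /\
    forall N u, J u -> O N u ->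
      exists2 q, (forall i, O (N - c)%N (q i)) & u = \sum_i q i * h i;
  adic_unit : forall u, O 1%N u \/ exists v, v * u = 1;
  adic_proper : ~ O 1%N 1;
  adic_findim : forall N, exists (I : finType) (b : I -> A),
    forall u, exists c : I -> K, O N (u - \sum_i c i *: b i) }.

(** * Dickson's lemma *)

Section Dickson.

Lemma nat_seq_min (u : nat -> nat) (m : nat) :
  exists p, (m < p)%N /\ forall q, (m < q)%N -> (u p <= u q)%N.
Proof.
have [v [p [mp <-]] vmin] : exists2 v, exists p, (m < p)%N /\ u p = v &
    forall q, (m < q)%N -> (v <= u q)%N.
  have ex : exists v, `[< exists p, (m < p)%N /\ u p = v >].
    by exists (u m.+1); apply/asboolP; exists m.+1.
  exists (ex_minn ex); case: ex_minnP => v /asboolP[p [mp <-]] vmin.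
    by exists p.
  by move=> q mq; apply: vmin; apply/asboolP; exists q.
by exists p.
Qed.

(** Each index is chosen so that its value is the minimum over all indices beyond the previous
    one. *)
Lemma nat_seq_mono (u : nat -> nat) : exists phi : nat -> nat,
  {homo phi : i j / (i < j)%N} /\ {homo u \o phi : i j / (i <= j)%N}.
Proof.
have [next nextP] := choice (nat_seq_min u).
pose phi i := iter i.+1 next 0%N.
have phiS i : (phi i < phi i.+1)%N by rewrite /phi iterS; case: (nextP (phi i)).
exists phi; split.
  by apply: homo_ltn => // ? ? ?; apply: ltn_trans.
apply: homo_leq => [x|y x z|i]; [exact: leqnn | exact: leq_trans | ].
rewrite /= {1}/phi iterS; have [_] := nextP (iter i next 0%N); apply.
by apply: ltn_trans (phiS i); case: (nextP (iter i next 0%N)).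
Qed.

(** Monotone subsequences are extracted for one coordinate after another. *)
Lemma multinom_seq_mono n (u : nat -> 'X_{1..n}) : exists phi : nat -> nat,
  {homo phi : i j / (i < j)%N} /\
  forall i j, (i <= j)%N -> (u (phi i) <= u (phi j))%MM.
Proof.
suff /(_ (enum 'I_n))[phi [phiS um]] : forall s : seq 'I_n, exists phi : nat -> nat,
    {homo phi : i j / (i < j)%N} /\
    forall k, k \in s -> forall i j, (i <= j)%N -> (u (phi i) k <= u (phi j) k)%N.
  exists phi; split=> // i j ij; apply/mnm_lepP => k.
  by apply: um => //; rewrite mem_enum.
elim=> [|k s [phi [phiS um]]]; first by exists id; split=> [i j|k].
have [psi [psiS vm]] := nat_seq_mono (fun i => u (phi i) k).
exists (phi \o psi); split; first by move=> i j ij; apply/phiS/psiS.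
move=> l; rewrite in_cons => /orP[/eqP->|ls] i j ij; first exact: vm.
apply: um => //=; move: ij; rewrite leq_eqVlt => /orP[/eqP->//|].
by move=> /psiS /ltnW.
Qed.

(** Otherwise a greedy choice gives an infinite sequence in [E] no term of which is divisible by an
    earlier one, against [multinom_seq_mono]. *)
Lemma dickson n (E : set 'X_{1..n}) : exists s : seq 'X_{1..n},
  (forall a, a \in s -> E a) /\
  forall a, E a -> exists2 b, b \in s & (b <= a)%MM.
Proof.
apply: contrapT => noS.
have /choice[next nextP] : forall s : seq 'X_{1..n}, exists a,
    (forall b, b \in s -> E b) ->
    E a /\ forall b, b \in s -> ~~ (b <= a)%MM.
  move=> s; have [sE|] := pselect (forall b, b \in s -> E b); last first.
    by move=> sE; exists 0%MM => /sE.
  have [a aP] : exists a, ~ (E a -> exists2 b, b \in s & (b <= a)%MM).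
    by apply: contrapT => na; apply: noS; exists s; split=> // a; apply: contrapT => ?; apply: na; exists a.
  exists a => _; have [Ea nb] := (not_implyP _ _).1 aP.
  by split=> // b bs; apply/negP => ba; apply: nb; exists b.
pose sq i := iter i (fun s => rcons s (next s)) [::].
have sqE i b : b \in sq i -> E b.
  elim: i b => [|i IH] b //=; rewrite mem_rcons in_cons => /orP[/eqP->|/IH//].
  by have [] := nextP (sq i) IH.
have sq_in i j : (i < j)%N -> next (sq i) \in sq j.
  elim: j => // j IH; rewrite ltnS leq_eqVlt /= mem_rcons in_cons.
  by move=> /orP[/eqP->|/IH->]; rewrite ?eqxx ?orbT.
have [phi [phiS um]] := multinom_seq_mono (fun i => next (sq i)).
have [_ /(_ (next (sq (phi 0%N))))] := nextP (sq (phi 1%N)) (sqE _).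
by move=> /(_ (sq_in _ _ (phiS _ _ _)))/negP; apply => //; apply: um.
Qed.

End Dickson.

(** * Division of convergent power series *)

Lemma sum_bm_shift n (V : nmodType) D (c : 'X_{1..n}) (F : 'X_{1..n} -> V) :
  (forall a, F a != 0 -> (c <= a)%MM) ->
  \sum_(a : 'X_{1..n < D}) F a =
    \sum_(e : 'X_{1..n < D} | (mdeg (e + c)%MM < D)%N) F (e + c)%MM.
Proof.
move=> Fc.
have lt_sub (a : 'X_{1..n < D}) : (mdeg (a - c)%MM < D)%N.
  exact: leq_ltn_trans (mdegB _ _) (bmdeg a).
rewrite [RHS](reindex_omap (fun a => BMultinom (lt_sub a))
    (fun e : 'X_{1..n < D} => insub (e + c)%MM)) /=; last first.
  move=> e lt_e; rewrite insubT /=; congr Some; apply: val_inj.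
  by rewrite /= addmK.
rewrite (bigID (fun a : 'X_{1..n < D} => (c <= a)%MM)) /= addrC big1 ?add0r.
  apply: eq_big => a; last by move=> ca; rewrite submK.
  apply/idP/andP => [ca|[_ /eqP]].
    by rewrite submK // bmdeg; split=> //; rewrite insubT ?bmdeg // => ?;
       apply/eqP; congr Some; apply: val_inj.
  by case: insubP => // u _ ua [<-]; rewrite ua lem_addl.
by move=> a /negP ca; apply/eqP; apply: contra_notT ca => /Fc.
Qed.

(** * Norms on polydiscs *)

Section Weights.
Variables (n : nat) (K : numFieldType).
Implicit Types (w : 'I_n -> K) (a b c : 'X_{1..n}) (f g : fps n K).

(** The value of [x^a] at the polyradius [w]. A separate radius for each variable is what lets one
    monomial dominate others of the same degree. *)
Definition wt w a : K := \prod_(i < n) w i ^+ a i.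

Lemma wtD w a b : wt w (a + b)%MM = wt w a * wt w b.
Proof. by rewrite -big_split; apply: eq_bigr => i _; rewrite mnmDE exprD. Qed.

Lemma wt_gt0 w a : (forall i, 0 < w i) -> 0 < wt w a.
Proof. by move=> w0; apply: prodr_gt0 => i _; rewrite exprn_gt0. Qed.

Lemma wt_const r a : wt (fun=> r) a = r ^+ mdeg a.
Proof. by rewrite /wt prodrXr mdegE. Qed.

Definition psum w f d : K := \sum_(a : 'X_{1..n < d}) `|f a| * wt w a.

Lemma psum_ge0 w f d : (forall i, 0 < w i) -> 0 <= psum w f d.
Proof. by move=> w0; apply: sumr_ge0 => a _; rewrite mulr_ge0 // ltW // wt_gt0. Qed.

Lemma psum_mono w w' f d : (forall i, 0 < w i) -> (forall i, w i <= w' i) ->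
  psum w f d <= psum w' f d.
Proof.
move=> w0 ww; apply: ler_sum => a _; rewrite ler_wpM2l //.
apply: ler_prod => i _; rewrite exprn_ge0 ?(ltW (w0 i)) //=.
by rewrite lerXn2r ?nnegrE // ltW // (lt_le_trans (w0 i)).
Qed.

Lemma exists_pos_lower_bound (I : finType) (w : I -> K) : (forall i, 0 < w i) ->
  exists2 r, 0 < r & forall i, r <= w i.
Proof.
move=> w0; suff /(_ (enum I))[r r0 rw] : forall s : seq I,
    exists2 r, 0 < r & forall i, i \in s -> r <= w i.
  by exists r => // i; apply: rw; rewrite mem_enum.
elim=> [|i s [r r0 rw]]; first by exists 1.
have /orP[ri|ir] : (r <= w i) || (w i <= r).
  exact: (real_comparable (gtr0_real r0) (gtr0_real (w0 i))).
  by exists r => // j; rewrite in_cons => /orP[/eqP->|/rw].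
exists (w i) => // j; rewrite in_cons => /orP[/eqP->//|/rw].
exact: le_trans.
Qed.

Lemma convergent_wt w f M : (forall i, 0 < w i) ->
  (forall d, psum w f d <= M) -> convergent f.
Proof.
move=> w0 fM; have [r r0 rw] := exists_pos_lower_bound w0.
exists r, M; split=> // d; apply: le_trans (fM d).
apply: le_trans (psum_mono f d (fun=> r0) rw).
by apply: ler_sum => a _; rewrite wt_const.
Qed.

End Weights.

(** * Formal division and its estimates *)

Section Division.
Variables (n : nat) (K : numFieldType) (s : nat).
Variables (h : 'I_s -> fps n K) (lead : 'I_s -> 'X_{1..n}).
Hypothesis h_lead : forall j, h j (lead j) = 1.
Hypothesis h_lt : forall j b, (b < lead j)%O -> h j b = 0.
Variable f : fps n K.
Implicit Types (a b c : 'X_{1..n}).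

Definition cone a : option 'I_s := [pick j | (lead j <= a)%MM].

(* The coefficient of [x^b] in [x^(a - lead j) * h j], for the divisor [j]
   chosen for the monomial [x^a]. *)
Definition divisor_coef a b : K :=
  if cone a is Some j then
    if (a - lead j <= b)%MM then h j (b - (a - lead j))%MM else 0
  else 0.

Lemma coneP a j : cone a = Some j -> (lead j <= a)%MM.
Proof. by rewrite /cone; case: pickP => // i ? [<-]. Qed.

Lemma divisor_coef_le a b : divisor_coef a b != 0 -> (a <= b)%O.
Proof.
rewrite /divisor_coef; case E: (cone a) => [j|]; last by rewrite eqxx.
have ja := coneP E; case: ifP => [ab|]; last by rewrite eqxx.
move=> hn0; rewrite -(submK ja) -(submK ab) [X in (X <= _)%O]addmC lem_add //.
by rewrite leNgt; apply: contra_neqN hn0 => /h_lt.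
Qed.

Lemma divisor_coef_diag a j : cone a = Some j -> divisor_coef a a = 1.
Proof.
move=> E; rewrite /divisor_coef E; have ja := coneP E.
by rewrite lem_subr submBA // addmC addmK h_lead.
Qed.

(** The sum is finite because [a < b] forces [mdeg a <= mdeg b]; matching on [@idP] supplies the
    proof of [a < b] that the recursion asks for. *)
Definition rem_step b (rec : forall a, (a < b)%O -> K) : K :=
  f b - \sum_(a : 'X_{1..n < (mdeg b).+1})
    match @idP (bmnm a < b)%O with
    | ReflectT ab => rec a ab * divisor_coef a b
    | ReflectF _ => 0
    end.

(* [division_coef b] is the coefficient of [x^b] that is still to be divided
   once all smaller monomials have been dealt with. *)
Definition division_coef : fps n K := Fix (@ltom_wf n) (fun=> K) rem_step.

Lemma division_coefE b d : (mdeg b < d)%N -> division_coef b =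
  f b - \sum_(a : 'X_{1..n < d} | (bmnm a < b)%O) division_coef a * divisor_coef a b.
Proof.
move=> lt_bd; rewrite {1}/division_coef Fix_eq; last first.
  move=> x u v uv; congr (_ - _); apply: eq_bigr => a _.
  by case: {-}_ / idP => // ab; rewrite uv.
rewrite -/division_coef /rem_step; congr (_ - _).
rewrite (eq_bigr (fun a : 'X_{1..n < (mdeg b).+1} =>
   if (bmnm a < b)%O then division_coef a * divisor_coef a b else 0)); last first.
  by move=> a _; case: {-}_ / idP => [->|/negP/negPf->].
rewrite -big_mkcond /=.
have le_d : ((mdeg b).+1 <= d)%N by [].
pose wid (a : 'X_{1..n < (mdeg b).+1}) : 'X_{1..n < d} :=
  BMultinom (leq_trans (bmdeg a) le_d).
rewrite [RHS](reindex_omap wid (fun a : 'X_{1..n < d} => insub (bmnm a))) /=.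
  apply: eq_bigl => a; rewrite valK eqxx andbT //.
move=> a ab; rewrite insubT ?ltnS ?lemc_mdeg ?(ltW ab) //= => lt_a.
by congr Some; apply: val_inj.
Qed.


Lemma fps_mul_single (q g : fps n K) b d : (mdeg b < d)%N ->
  (q * g) b = \sum_(c : 'X_{1..n < d} | (c <= b)%MM) q c * g (b - c)%MM.
Proof.
move=> lt_bd; rewrite [LHS](fps_mulE _ _ lt_bd).
have lt_sub (c : 'X_{1..n < d}) : (mdeg (b - c)%MM < d)%N.
  exact: leq_ltn_trans (mdegB _ _) lt_bd.
rewrite (reindex_omap (fun c : 'X_{1..n < d} => (c, BMultinom (lt_sub c)))
   (fun x => Some x.1)) /=.
  apply: eq_bigl => c; rewrite eqxx andbT; apply/eqP/idP => [->|cb].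
    exact: lem_addr.
  by rewrite addmC submK.
move=> [c e] /eqP /= E; congr (Some (_, _)); apply: val_inj => /=.
by rewrite E addmC addmK.
Qed.

Definition quo j : fps n K := fun c =>
  if cone (c + lead j)%MM == Some j then division_coef (c + lead j)%MM else 0.

Definition rmd : fps n K := fun b => if cone b is Some _ then 0 else division_coef b.

(** The same products are grouped by divisor on the left and by divided monomial on the right. *)
Lemma quo_mulE b d : (mdeg b < d)%N -> \sum_j (quo j * h j) b =
  \sum_(a : 'X_{1..n < d}) division_coef a * divisor_coef a b.
Proof.
move=> lt_bd.
pose F j a := if (cone a == Some j) && (a - lead j <= b)%MM then
  division_coef a * h j (b - (a - lead j))%MM else 0.
transitivity (\sum_(a : 'X_{1..n < d}) \sum_j F j a); last first.
  apply: eq_bigr => a _; rewrite /divisor_coef /F.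
  case: (cone a) => [j|]; last by rewrite mulr0 big1.
  rewrite (bigD1 j) //= big1 ?addr0 => [|i ij]; first by rewrite eqxx /=; case: ifP => // _; rewrite mulr0.
  by rewrite (negPf (_ : Some j != Some i)) //; apply: contraNneq ij => -[->].
rewrite [RHS]exchange_big /=; apply: eq_bigr => j _.
rewrite (fps_mul_single _ _ lt_bd) (sum_bm_shift _ (c := lead j)); last first.
  by move=> a; rewrite /F; case: (cone a =P Some j) => [/coneP->//|_] /=; rewrite eqxx.
rewrite big_mkcond [RHS]big_mkcond; apply: eq_bigr => e _.
rewrite /F /quo addmK; case: (cone _ == Some j) => /=; last by rewrite mul0r !if_same.
case: ifP => [eb|_]; last by rewrite if_same.
(* If [e + lead j] has degree at least [d], then [b - e] has smaller degree than [lead j], and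
   [h_lt] applies. *)
case: ifP => // /negP lt_d; rewrite h_lt ?mulr0 //.
apply: lt_mdeg_ltmc; rewrite ltnNge; apply/negP => le_j; apply: lt_d.
by rewrite (leq_ltn_trans _ lt_bd) // -(submK eb) !mdegD addnC leq_add2r.
Qed.

(** The coefficient of [x^b] receives contributions only from [a <= b]: those with [a < b] are what
    the recursion subtracted from [f b], and [a = b] falls to the quotients or to [rmd] according to
    [cone b]. *)
Lemma division_eq : f = \sum_j quo j * h j + rmd.
Proof.
apply: funext => b.
have -> : (\sum_j quo j * h j + rmd) b = \sum_j (quo j * h j) b + rmd b.
  rewrite {1}/GRing.add /=; congr (_ + _).
  by apply: (big_morph (fun g : fps n K => g b)).
rewrite (quo_mulE (ltnSn _)) (bigID (fun a : 'X_{1..n < _} => (bmnm a < b)%O)) /=.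
apply/eqP; rewrite -addrA addrC -subr_eq -(division_coefE (ltnSn _)).
rewrite (bigD1 (BMultinom (ltnSn (mdeg b)))) ?ltxx //= big1 ?addr0; last first.
  move=> a /andP[ab ne]; apply/eqP; rewrite mulf_eq0; apply/orP; right.
  apply: contraNT ab => /divisor_coef_le; rewrite le_eqVlt => /orP[/eqP E|//].
  by case/eqP: ne; apply: val_inj.
rewrite /rmd; case E: (cone b) => [j|]; first by rewrite (divisor_coef_diag E) mulr1 addr0.
by rewrite /divisor_coef E mulr0 add0r.
Qed.

Lemma rmd_cone a j : rmd a != 0 -> ~~ (lead j <= a)%MM.
Proof. by rewrite /rmd /cone; case: pickP => [i _|/(_ j)->//]; rewrite eqxx. Qed.

Lemma division_coef_order N : (forall b, (mdeg b < N)%N -> f b = 0) ->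
  forall b, (mdeg b < N)%N -> division_coef b = 0.
Proof.
move=> fN; elim/(@ltmwf n) => b IH lt_b.
rewrite (division_coefE (ltnSn _)) fN // big1 ?subr0 // => a ab.
by rewrite IH ?mul0r // (leq_ltn_trans _ lt_b) // lemc_mdeg // ltW.
Qed.

Section Bounds.
Variables (w : 'I_n -> K) (M : K).
Hypothesis w_gt0 : forall i, 0 < w i.
Hypothesis h_small : forall j d,
  \sum_(e : 'X_{1..n < d} | bmnm e != lead j) `|h j e| * wt w e <= 2^-1 * wt w (lead j).
Hypothesis f_bound : forall d, psum w f d <= M.

(** This is [h_small] scaled by the weight of [x^(a - lead j)]. *)
Lemma divisor_coef_tail a d :
  \sum_(b : 'X_{1..n < d} | (a < b)%O) `|divisor_coef a b| * wt w b <= 2^-1 * wt w a.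
Proof.
have wt0 b : 0 < wt w b by apply: wt_gt0.
rewrite /divisor_coef; case E: (cone a) => [j|]; last first.
  by rewrite big1 ?mulr_ge0 ?invr_ge0 ?ler0n ?ltW // => b _; rewrite normr0 mul0r.
have ja := coneP E; set c := (a - lead j)%MM.
pose F b := if (c <= b)%MM && (b != a) then `|h j (b - c)%MM| * wt w b else 0.
apply: (@le_trans _ _ (\sum_(b : 'X_{1..n < d}) F b)).
  rewrite big_mkcond; apply: ler_sum => b _; rewrite /F.
  case: ltP => [ab|_]; last by case: ifP; rewrite // mulr_ge0 // ltW.
  by rewrite (gt_eqF ab) andbT; case: ifP => //; rewrite normr0 mul0r.
rewrite (sum_bm_shift _ (c := c)); last by move=> b; rewrite /F; case: (c <= b)%MM; rewrite ?eqxx.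
rewrite -(submK ja) -/c wtD [_ * wt w (lead j)]mulrC mulrA.
apply: le_trans (ler_wpM2r (ltW (wt0 c)) (h_small j d)).
rewrite mulr_suml big_mkcond [leRHS]big_mkcond; apply: ler_sum => e _.
rewrite /F addmK lem_addl wtD mulrA /= -{1}(submK ja) [in X in X == _]addmC eqm_add2l.
by case: ifP; case: ifP => // *; rewrite !mulr_ge0 // ltW.
Qed.

(** The recursion and [divisor_coef_tail] bound the partial sum [P] by [psum w f d + P / 2]. As [P]
    is a finite sum, [P / 2] can be absorbed. *)
Lemma division_coef_bound d : psum w division_coef d <= 2 * M.
Proof.
have wt0 b : 0 < wt w b by apply: wt_gt0.
suff : psum w division_coef d <= psum w f d + 2^-1 * psum w division_coef d.
  move=> le_P; rewrite -ler_pdivrMl //; apply: le_trans (f_bound d).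
  rewrite -(lerD2r (2^-1 * psum w division_coef d)); apply: le_trans le_P.
  rewrite (_ : _ + _ = psum w division_coef d) //.
  by set P := psum _ _ _; field.
apply: (@le_trans _ _ (psum w f d + \sum_(b : 'X_{1..n < d})
   \sum_(a : 'X_{1..n < d} | (bmnm a < b)%O)
     `|division_coef a| * (`|divisor_coef a b| * wt w b))).
  rewrite -big_split; apply: ler_sum => b _ /=.
  rewrite {1}(division_coefE (bmdeg b)).
  apply: le_trans (ler_wpM2r (ltW (wt0 b)) (ler_normB _ _)) _.
  rewrite mulrDl lerD2l; apply: le_trans (ler_wpM2r (ltW (wt0 b)) (ler_norm_sum _ _ _)) _.
  by rewrite mulr_suml ler_sum // => a _; rewrite normrM mulrA.
rewrite lerD2l (exchange_big_dep xpredT) //= /psum mulr_sumr; apply: ler_sum => a _.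
rewrite -mulr_sumr mulrCA ler_wpM2l //; exact: divisor_coef_tail.
Qed.

Lemma quo_convergent j : convergent (quo j).
Proof.
have wt0 b : 0 < wt w b by apply: wt_gt0.
apply: (convergent_wt (w := w) (M := 2 * M / wt w (lead j))) => // d.
rewrite ler_pdivlMr // mulr_suml.
apply: le_trans (division_coef_bound (d + mdeg (lead j))%N).
pose F a := if (lead j <= a)%MM then `|division_coef a| * wt w a else 0.
apply: (@le_trans _ _ (\sum_(a : 'X_{1..n < d + mdeg (lead j)}) F a)); last first.
  by apply: ler_sum => a _; rewrite /F; case: ifP => // _; rewrite mulr_ge0 // ltW.
rewrite (sum_bm_shift _ (c := lead j)); last by move=> a; rewrite /F; case: ifP; rewrite ?eqxx.
have le_d : (d <= d + mdeg (lead j))%N by apply: leq_addr.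
pose wid (a : 'X_{1..n < d}) : 'X_{1..n < d + mdeg (lead j)} :=
  BMultinom (leq_trans (bmdeg a) le_d).
rewrite [leRHS](reindex_omap wid (fun a : 'X_{1..n < _} => insub (bmnm a))) /=; last first.
  move=> a; rewrite mdegD ltn_add2r => lt_a; rewrite insubT /=.
  by congr Some; apply: val_inj.
rewrite big_mkcond [leRHS]big_mkcond; apply: ler_sum => e _.
rewrite valK eqxx andbT mdegD ltn_add2r bmdeg /F lem_addl wtD mulrA.
rewrite ler_wpM2r ?(ltW (wt0 _)) // ler_wpM2r ?(ltW (wt0 _)) // /quo.
by case: ifP; rewrite // normr0.
Qed.

Lemma rmd_convergent : convergent rmd.
Proof.
have wt0 b : 0 < wt w b by apply: wt_gt0.
apply: (convergent_wt (w := w) (M := 2 * M)) => // d.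
apply: le_trans (division_coef_bound d); apply: ler_sum => a _.
by rewrite ler_wpM2r ?(ltW (wt0 _)) // /rmd; case: (cone _); rewrite ?normr0.
Qed.

End Bounds.

End Division.

(** Reads [a] as a number with base-[D] digits, the first variable being the most significant. *)
Definition lex_weight n D (a : 'X_{1..n}) : nat := \sum_(i < n) a i * D ^ (n - i.+1).

Lemma lex_weight_lt n D (a b : 'X_{1..n}) : mdeg a = mdeg b -> (mdeg a < D)%N ->
  (a < b)%O -> (lex_weight D a < lex_weight D b)%N.
Proof.
move=> ab aD /(ltmcP ab)[i eq_lt lt_i].
have D0 : (0 < D)%N by apply: leq_ltn_trans aD.
rewrite /lex_weight (bigID (fun j : 'I_n => (j < i)%N)) /=.
rewrite [X in (_ < X)%N](bigID (fun j : 'I_n => (j < i)%N)) /=.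
rewrite (eq_bigr (fun j : 'I_n => (b j * D ^ (n - j.+1))%N)); last by move=> j /eq_lt->.
rewrite ltn_add2l (bigD1 i) ?ltnn //= [X in (_ < X)%N](bigD1 i) ?ltnn //=.
apply: leq_trans (leq_addr _ _).
apply: (@leq_trans ((a i).+1 * D ^ (n - i.+1))); last by rewrite leq_mul2r lt_i orbT.
(* After multiplication by [D], the digits beyond [i] amount to at most [mdeg a * D ^ (n - i.+1)],
   which is below [D * D ^ (n - i.+1)]. *)
rewrite mulSn addnC ltn_add2r -(ltn_pmul2l D0).
apply: (@leq_ltn_trans (mdeg a * D ^ (n - i.+1))); last first.
  by rewrite ltn_pmul2r ?expn_gt0 ?D0.
rewrite big_distrr mdegE big_distrl /= [X in (_ <= X)%N](bigID (fun j : 'I_n => ~~ (j < i)%N && (j != i))) /=.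
apply: leq_trans (leq_addr _ _); apply: leq_sum => j /andP[ij ne].
rewrite mulnCA -expnS leq_mul2l leq_pexp2l ?orbT //.
have lt_ij : (i < j)%N.
  by rewrite ltn_neqAle eq_sym leqNgt ij andbT; apply: contraNneq ne => /val_inj->.
by have := ltn_ord j; lia.
Qed.

(** * Weights under which the leading terms dominate *)

Section SmallWeights.
Variables (n : nat) (K : numFieldType).

Lemma exists_pos_small (I : finType) (w : I -> K) : (forall i, 0 < w i) ->
  exists t, [/\ 0 < t, t <= 1 & forall i, t <= w i].
Proof.
move=> w0; have [|t t0 tw] := @exists_pos_lower_bound _ (option I)
  (fun o => if o is Some i then w i else 1); first by case.
by exists t; split=> [//||i]; [apply: (tw None) | apply: (tw (Some i))].
Qed.

Lemma common_radius (I : finType) (g : I -> fps n K) :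
  (forall i, convergent (g i)) -> exists r M, [/\ 0 < r, 0 <= M &
    forall i d, psum (fun=> r) (g i) d <= M].
Proof.
move=> cg; have /choice[rM rMP] : forall i, exists rM : K * K, 0 < rM.1 /\
    forall d, psum (fun=> rM.1) (g i) d <= rM.2.
  move=> i; have [r [M [r0 gM]]] := cg i; exists (r, M); split=> // d.
  by apply: le_trans (gM d); apply: ler_sum => a _; rewrite wt_const.
have M0 i : 0 <= (rM i).2.
  have [r0 /(_ 0%N)] := rMP i; apply: le_trans; exact: psum_ge0.
have [|r r0 rw] := @exists_pos_lower_bound _ I (fun i => (rM i).1).
  by move=> i; have [] := rMP i.
exists r, (\sum_i (rM i).2); split=> // [|i d]; first by apply: sumr_ge0.
apply: le_trans (psum_mono (g i) d (fun=> r0) (fun=> rw i)) _.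
have [_ /(_ d) le_i] := rMP i; apply: le_trans le_i _.
by rewrite (bigD1 i) //= lerDl sumr_ge0.
Qed.

Variables (s : nat) (h : 'I_s -> fps n K) (lead : 'I_s -> 'X_{1..n}).
Hypothesis h_conv : forall j, convergent (h j).
Hypothesis h_lt : forall j b, (b < lead j)%O -> h j b = 0.

(* With [w i = r u t^(D^(n-1-i))], the terms of [h j] of the same degree as
   the leading one are made small by [t], those of higher degree by [u]. *)
Lemma exists_small_weights (f : fps n K) : convergent f -> exists w M,
  [/\ forall i : 'I_n, 0 < w i,
    forall j d, \sum_(e : 'X_{1..n < d} | bmnm e != lead j)
       `|h j e| * wt w e <= 2^-1 * wt w (lead j) &
    forall d, psum w f d <= M].
Proof.
move=> f_conv.
have [|r [M [r0 M0 gM]]] := @common_radius (option 'I_s)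
  (fun o => if o is Some j then h j else f); first by case.
(* [kap] compensates the bound [M] on the norms: it suffices that each non-leading term be at most
   [kap * wt w (lead j)] times its size at radius [r]. *)
have [kap kap0 kapM] : exists2 kap : K, 0 < kap & M * kap <= 2^-1.
  have M1 : 0 < M + 1 by rewrite ltr_wpDl.
  exists (2^-1 / (M + 1)); first by rewrite divr_gt0 ?invr_gt0 ?ltr0n.
  rewrite mulrCA -[leRHS]mulr1 ler_wpM2l ?invr_ge0 ?ler0n //.
  by rewrite ler_pdivrMr // mul1r lerDl.
pose D := (\max_j mdeg (lead j)).+1.
have leadD j : (mdeg (lead j) < D)%N by rewrite ltnS (leq_bigmax j).
have [|t [t0 t1 tP]] := @exists_pos_small _ (fun j => kap * r ^+ mdeg (lead j)).
  by move=> j; rewrite mulr_gt0 ?exprn_gt0.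
(* In higher degree [e] may have a smaller [lex_weight] than [lead j], so [u] is chosen after [t]
   and small against a power of it. *)
have [|u [u0 u1 uP]] := @exists_pos_small _
    (fun j => kap * r ^+ mdeg (lead j) * t ^+ lex_weight D (lead j)).
  by move=> j; do !apply: mulr_gt0 => //; rewrite ?exprn_gt0.
pose w (i : 'I_n) := r * u * t ^+ (D ^ (n - i.+1)).
have w0 i : 0 < w i by do !apply: mulr_gt0 => //; rewrite ?exprn_gt0.
have wtE a : wt w a = r ^+ mdeg a * u ^+ mdeg a * t ^+ lex_weight D a.
  rewrite -exprMn -wt_const /lex_weight /wt -prodrXr -big_split /=.
  by apply: eq_bigr => i _; rewrite exprMn -exprM mulnC.
exists w, M; split=> // [j d|d]; last first.
  apply: le_trans (gM None d); apply: psum_mono => // i.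
  rewrite /w -mulrA ler_piMr ?(ltW r0) // mulr_ile1 ?exprn_ge0 ?exprn_ile1 //;
  exact: ltW.
have term e : e != lead j ->
    `|h j e| * wt w e <= `|h j e| * wt (fun=> r) e * (kap * wt w (lead j)).
  move=> ne; have [lt_e|lt_e|E] := ltgtP e (lead j).
  - by rewrite h_lt // normr0 !mul0r.
  - rewrite -mulrA ler_wpM2l // wt_const wtE -mulrA ler_wpM2l ?exprn_ge0 ?(ltW r0) //.
    have := lemc_mdeg (ltW lt_e); rewrite leq_eqVlt => /orP[/eqP Edeg|lt_deg].
      apply: (@le_trans _ _ (u ^+ mdeg e * (t ^+ lex_weight D (lead j) * t))).
        rewrite ler_wpM2l ?exprn_ge0 ?(ltW u0) // -exprSr.
        rewrite ler_wiXn2l ?(ltW t0) //.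
        by apply: lex_weight_lt => //; rewrite leadD.
      rewrite wtE Edeg.
      apply: le_trans (ler_wpM2l _ (ler_wpM2l _ (tP j))) _; rewrite ?exprn_ge0 ?(ltW u0) ?(ltW t0) //.
      by rewrite Edeg le_eqVlt; apply/orP; left; apply/eqP; ring.
    apply: (@le_trans _ _ (u ^+ (mdeg (lead j)).+1)).
      apply: (@le_trans _ _ (u ^+ mdeg e)).
        by rewrite ler_piMr ?exprn_ge0 ?exprn_ile1 ?(ltW u0) ?(ltW t0).
      by rewrite ler_wiXn2l ?(ltW u0).
    rewrite exprSr wtE; apply: le_trans (ler_wpM2l _ (uP j)) _; rewrite ?exprn_ge0 ?(ltW u0) //.
    by rewrite le_eqVlt; apply/orP; left; apply/eqP; ring.
  - by rewrite E eqxx in ne.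
apply: (@le_trans _ _ (psum (fun=> r) (h j) d * (kap * wt w (lead j)))).
  rewrite mulr_suml big_mkcond; apply: ler_sum => e _; case: ifP => [/term//|_].
  by do !apply: mulr_ge0 => //; apply: ltW => //; apply: wt_gt0.
rewrite mulrA ler_wpM2r ?(ltW (wt_gt0 _ w0)) //.
exact: le_trans (ler_wpM2r (ltW kap0) (gM (Some j) d)) kapM.
Qed.

End SmallWeights.

(** * Division by a standard basis *)

Section ConvergentDivision.
Variables (n : nat) (K : numFieldType).
Implicit Types (f g : cps n K) (a b c : 'X_{1..n}).

Lemma cpsP f g : (forall a, cps_val f a = cps_val g a) -> f = g.
Proof. by move=> fg; apply: val_inj; apply: funext. Qed.

Lemma cpsD f g a : cps_val (f + g) a = cps_val f a + cps_val g a.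
Proof. by []. Qed.

Lemma cpsN f a : cps_val (- f) a = - cps_val f a.
Proof. by []. Qed.

Lemma cpsZ (t : K) f a : cps_val (t *: f) a = t * cps_val f a.
Proof. by []. Qed.

Lemma cps_valM f g : cps_val (f * g) = cps_val f * cps_val g.
Proof. by []. Qed.

Lemma cps_sum (I : Type) (r : seq I) (P : pred I) (F : I -> cps n K) a :
  cps_val (\sum_(i <- r | P i) F i) a = \sum_(i <- r | P i) cps_val (F i) a.
Proof. by apply: (big_morph (fun f => cps_val f a)). Qed.

Lemma cps_convergent f : convergent (cps_val f).
Proof. by apply/convergentbP; case: f. Qed.

Definition mk_cps (f : fps n K) (cf : convergent f) : cps n K :=
  Cps (introT (convergentbP f) cf).

Section Order.
Variable N : nat.

Definition cps_ord_set : set (cps n K) :=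
  [set f | forall a, (mdeg a < N)%N -> cps_val f a = 0].

Lemma cps_ord_set0 : cps_ord_set 0. Proof. by []. Qed.

Lemma cps_ord_setD f g : cps_ord_set f -> cps_ord_set g -> cps_ord_set (f + g).
Proof. by move=> fN gN a aN; rewrite cpsD fN // gN // addr0. Qed.

Lemma cps_ord_setM f g : cps_ord_set g -> cps_ord_set (f * g).
Proof.
move=> gN a aN; rewrite cps_valM (fps_mul_single _ _ aN) big1 // => c ca.
by rewrite gN ?mulr0 // (leq_ltn_trans (mdegB _ _)).
Qed.

Definition cps_ord : ideal (cps n K) :=
  Ideal cps_ord_set0 cps_ord_setD cps_ord_setM.

End Order.

Definition is_lead f a := cps_val f a != 0 /\ forall b, (b < a)%O -> cps_val f b = 0.

Lemma exists_lead f : f != 0 -> exists a, is_lead f a.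
Proof.
move=> f0; apply: contrapT => nl; case/eqP: f0; apply: cpsP => a.
elim/(@ltmwf n): a => a IH; apply: contrapT => /eqP fa0.
by apply: nl; exists a; split.
Qed.

(** Dickson's lemma gives finitely many elements of [J] whose leading exponents divide all those of
    [J]. No monomial of the remainder is divisible by them, so a remainder in the closure of [J]
    vanishes. *)
Lemma cps_division (J : ideal (cps n K)) : exists s (h : 'I_s -> cps n K) k,
  (forall j, J (h j)) /\ forall f, exists q r,
  [/\ f = \sum_j q j * h j + r,
      forall N, cps_ord N f -> forall j, cps_ord (N - k) (q j) &
      (forall N, ideal_add J (cps_ord N) r) -> r = 0].
Proof.
pose E : set 'X_{1..n} := [set a | exists2 f, J f & is_lead f a].
have [leads [leadsE leadsP]] := dickson E.
pose s := size leads; pose lead (j : 'I_s) := tnth (in_tuple leads) j.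
have /choice[h hP] : forall j, exists f, [/\ J f, cps_val f (lead j) = 1 &
    forall b, (b < lead j)%O -> cps_val f b = 0].
  move=> j; have [f Jf [f0 f_lt]] := leadsE _ (mem_tnth j (in_tuple leads)).
  exists ((cps_val f (lead j))^-1 *: f); split=> [||b /f_lt fb]; first exact: idealZ.
    by rewrite cpsZ mulVf.
  by rewrite cpsZ fb mulr0.
have hJ j : J (h j) by have [] := hP j.
have h_lead j : cps_val (h j) (lead j) = 1 by have [] := hP j.
have h_lt j b : (b < lead j)%O -> cps_val (h j) b = 0.
  by have [_ _ h_lt] := hP j; apply: h_lt.
pose hv j := cps_val (h j).
(* Dividing by [lead j] lowers the order by at most [mdeg (lead j)]. *)
exists s, h, (\max_j mdeg (lead j)); split=> // f.
have [w [M [w0 h_small fM]]] :=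
  exists_small_weights (fun j => cps_convergent (h j)) h_lt (cps_convergent f).
have hv_small j d : \sum_(e : 'X_{1..n < d} | bmnm e != lead j)
    `|hv j e| * wt w e <= 2^-1 * wt w (lead j) by apply: h_small.
pose q j := mk_cps (quo_convergent w0 hv_small fM j).
pose r := mk_cps (rmd_convergent w0 hv_small fM).
exists q, r; split.
- apply: val_inj => /=; rewrite [LHS](@division_eq _ _ _ hv lead h_lead h_lt).
  rewrite [RHS](_ : _ = val (\sum_j q j * h j) + val r) //; congr (_ + _).
  by rewrite raddf_sum.
- move=> N fN j c cN; rewrite /= /quo; case: ifP => // _.
  apply: (division_coef_order _ _ fN); rewrite mdegD.
  have := leq_bigmax (F := fun j => mdeg (lead j)) j; move: cN.
  by rewrite ltn_subRL addnC; move=> lt_N le_j; apply: leq_ltn_trans lt_N; rewrite leq_add2l.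
- move=> Jr; apply/eqP/negPn/negP => /exists_lead[a [ra r_lt]].
  (* An element of [J] that agrees with [r] through degree [mdeg a] has the same leading exponent
     [a]. *)
  have [u [v [Ju vO Er]]] := Jr (mdeg a).+1.
  have uE b : (b <= a)%O -> cps_val u b = cps_val r b.
    by move=> ba; rewrite Er cpsD vO ?addr0 // ltnS lemc_mdeg.
  have Ea : E a.
    by exists u => //; split=> [|b ba]; rewrite uE // ?r_lt // ltW.
  have [b /(tnthP (in_tuple leads))[j Ej] ba] := leadsP a Ea.
  by have := rmd_cone j ra; rewrite /lead -Ej ba.
Qed.

End ConvergentDivision.
Arguments cps_ord {n K} N.

(** * The filtration of [K{x}] by order *)

Section ConvergentFiltration.
Variables (n : nat) (K : numFieldType).
Implicit Types (f g : cps n K) (a b c : 'X_{1..n}) (J : ideal (cps n K)).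

Lemma monomial_convergent a : convergent ((fun b => (b == a)%:R) : fps n K).
Proof.
apply: (@convergent_wt _ _ (fun=> 1) _ 1) => // d; rewrite /psum.
under eq_bigr do rewrite wt_const expr1n mulr1 normr_nat.
have [lt_a|le_d] := ltnP (mdeg a) d; last first.
  rewrite big1 ?ler01 // => b _; case: eqP => // E.
  by move: (bmdeg b); rewrite E ltnNge le_d.
rewrite (bigD1 (BMultinom lt_a)) //= eqxx big1 ?addr0 // => b.
by rewrite bmeqP /= => /negPf->.
Qed.

Definition monomial a : cps n K := mk_cps (monomial_convergent a).
#[local] Arguments monomial : simpl never.

Lemma monomialE a b : cps_val (monomial a) b = (b == a)%:R.
Proof. by []. Qed.

Lemma monomial_ord a : cps_ord (mdeg a) (monomial a).
Proof. by move=> b; rewrite monomialE; case: eqP => // ->; rewrite ltnn. Qed.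

Lemma mul_monomialE a f b : cps_val (monomial a * f) b =
  if (a <= b)%MM then cps_val f (b - a)%MM else 0.
Proof.
rewrite cps_valM (fps_mul_single _ _ (ltnSn (mdeg b))).
case: ifP => [ab|/negP ab].
  have lt_a : (mdeg a < (mdeg b).+1)%N.
    by rewrite ltnS; apply/lemc_mdeg/lem_leo.
  rewrite (bigD1 (BMultinom lt_a)) //= eqxx mul1r big1 ?addr0 // => c.
  by rewrite bmeqP => /andP[_ /negPf/=->]; rewrite mul0r.
rewrite big1 // => c cb; rewrite monomialE; case: eqP => [E|]; last by rewrite mul0r.
by case: ab; rewrite -E.
Qed.

Lemma monomialM a b : monomial (a + b)%MM = monomial a * monomial b.
Proof.
apply: cpsP => c; rewrite mul_monomialE !monomialE; case: ifP => [ac|/negP ac].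
  by rewrite -{1}(submK ac) [in LHS]addmC eqm_add2l.
by case: eqP ac => // -> []; rewrite lem_addr.
Qed.

Definition truncation N f : cps n K := \sum_(a : 'X_{1..n < N}) cps_val f a *: monomial a.

Lemma truncation_ord N f : cps_ord N (f - truncation N f).
Proof.
move=> a aN; rewrite cpsD cpsN cps_sum (bigD1 (BMultinom aN)) // big1.
  by rewrite cpsZ monomialE eqxx mulr1 /= addr0 subrr.
by move=> b; rewrite bmeqP cpsZ monomialE eq_sym => /negPf->; rewrite mulr0.
Qed.

(** The remainder of [f] is congruent to [f] modulo [J], so it too lies in the closure of [J] and
    therefore vanishes. *)
Lemma cps_ord_closed J f : (forall N, ideal_add J (cps_ord N) f) -> J f.
Proof.
move=> Jf; have [s [h [k [Jh /(_ f)[q [r [fE _ r0]]]]]]] := cps_division J.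
have Jq : J (\sum_j q j * h j) by apply: ideal_sum => j _; apply: idealM.
rewrite fE r0 ?addr0 // => N; have [u [v [Ju Nv Ef]]] := Jf N.
exists (u - \sum_j q j * h j), v; split=> //; first exact: idealB.
by rewrite addrAC -Ef fE addrAC subrr add0r.
Qed.

Lemma cps_artin_rees J : exists r (h : 'I_r -> cps n K) k, (forall i, J (h i)) /\
  forall N u, J u -> cps_ord N u ->
    exists2 q, (forall i, cps_ord (N - k)%N (q i)) & u = \sum_i q i * h i.
Proof.
have [s [h [k [Jh division]]]] := cps_division J; exists s, h, k; split=> // N u Ju uN.
have [q [r [uE qN r0]]] := division u; exists q; first exact: qN.
rewrite {1}uE r0 ?addr0 // => M; exists r, 0; split; rewrite ?addr0 //.
have -> : r = u - \sum_j q j * h j by rewrite uE addrAC subrr add0r.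
by apply: idealB => //; apply: ideal_sum => j _; apply: idealM.
Qed.

Lemma exists_divisor_mdeg a M : (M <= mdeg a)%N ->
  exists2 b, (b <= a)%MM & mdeg b = M.
Proof.
elim: M => [_|M IH lt_M]; first by exists 0%MM; rewrite ?mdeg0 //; apply/mnm_lepP => i; rewrite mnm0E.
have [b ba bM] := IH (ltnW lt_M).
have [i lt_i] : exists i, (b i < a i)%N.
  apply: contrapT => nlt; move: lt_M; rewrite -bM ltnNge => /negP; apply.
  rewrite !mdegE; apply: leq_sum => i _; rewrite leqNgt; apply/negP => lt_i.
  by apply: nlt; exists i.
exists (b + U_(i))%MM; last by rewrite mdegD mdeg1 bM addn1.
apply/mnm_lepP => j; rewrite mnmDE mnm1E; case: eqP => [<-|_]; first by rewrite addn1.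
by rewrite addn0; apply: (mnm_lepP ba).
Qed.

(** Closedness of [J] reduces the claim to truncations, which are finite sums of monomials. *)
Lemma cps_ord_monomials J N f : (forall a, (N <= mdeg a)%N -> J (monomial a)) ->
  cps_ord N f -> J f.
Proof.
move=> JN fN; apply: cps_ord_closed => D.
exists (truncation D f), (f - truncation D f); split; last by rewrite addrC subrK.
  apply: ideal_sum => a _; have [/fN->|/JN] := ltnP (mdeg a) N; last exact: idealZ.
  by rewrite scale0r; apply: ideal0.
exact: truncation_ord.
Qed.

Lemma cps_ord_monotone M N f : (M <= N)%N -> cps_ord N f -> cps_ord M f.
Proof. by move=> MN fN a /leq_trans/(_ MN)/fN. Qed.

Lemma cps_ordM M N f g : cps_ord M f -> cps_ord N g -> cps_ord (M + N) (f * g).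
Proof.
move=> fM gN a aMN; rewrite cps_valM (fps_mul_single _ _ (ltnSn (mdeg a))) big1 // => c ca.
have [/fM->|Mc] := ltnP (mdeg c) M; first by rewrite mul0r.
rewrite gN ?mulr0 // -(ltn_add2l M); apply: leq_ltn_trans aMN.
have := congr1 mdeg (submK ca); rewrite mdegD; lia.
Qed.

Lemma cps_val1 : cps_val (1 : cps n K) 0%MM = 1.
Proof. by rewrite [LHS](_ : _ = (0%MM == 0%MM :> 'X_{1..n})%:R) // eqxx. Qed.

(** No inverse series is constructed: for [t = 1 - f / f(0)], the multiple [1 - t ^+ N] of [f] tends
    to 1, so 1 lies in the closed ideal generated by [f]. *)
Lemma cps_ord_unit f : cps_ord 1 f \/ exists g, g * f = 1.
Proof.
have [f0|/eqP f0] := pselect (cps_val f 0%MM = 0).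
  by left=> a; rewrite ltnS leqn0 mdeg_eq0 => /eqP->.
right; pose t := 1 - (cps_val f 0%MM)^-1 *: f.
have t1 : cps_ord 1 t.
  move=> a; rewrite ltnS leqn0 mdeg_eq0 => /eqP->.
  by rewrite cpsD cpsN cpsZ mulVf // cps_val1 subrr.
have tN N : cps_ord N (t ^+ N).
  elim: N => [|N IH]; first by rewrite expr0.
  by rewrite exprS -add1n; apply: cps_ordM.
have /cps_ord_closed[r [a [s [sf E]]]] : forall N, ideal_add (ideal_span [set f]) (cps_ord N) 1.
  move=> N; exists (1 - t ^+ N), (t ^+ N); split; rewrite ?subrK //.
  rewrite -{1}(expr1n _ N) subrXX opprB addrC subrK -scalerAl; apply: idealZ.
  exists 1%N, (fun=> \sum_(i < N) 1 ^+ (N.-1 - i) * t ^+ i), (fun=> f); split=> //.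
  by rewrite big_ord1 mulrC.
exists (\sum_i a i); rewrite E mulr_suml; apply: eq_bigr => i _.
by rewrite (sf i).
Qed.

Lemma cps_adic : adic_filtration (@cps_ord n K).
Proof.
split.
- by [].
- by move=> N u; apply: cps_ord_monotone.
- exact: cps_ordM.
(* A monomial of degree at least [M + N] is the product of one of degree [M] and one of degree at
   least [N]. *)
- move=> J M N JMN u; apply: cps_ord_monomials => a le_a.
  have [b ba bM] := exists_divisor_mdeg (leq_trans (leq_addr N M) le_a).
  rewrite -(submK ba) monomialM mulrC; apply: JMN; first by rewrite -bM; apply: monomial_ord.
  apply: (@cps_ord_monotone _ (mdeg (a - b)%MM)); last exact: monomial_ord.
  by rewrite -(leq_add2l M) -{2}bM addnC [X in (_ <= X)%N]addnC -mdegD submK // addnC.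
- exact: cps_ord_closed.
- exact: cps_artin_rees.
- exact: cps_ord_unit.
- move=> /(_ 0%MM); rewrite mdeg0 => /(_ isT) /eqP.
  by rewrite cps_val1 oner_eq0.
- move=> N; exists 'X_{1..n < N}, (fun a : 'X_{1..n < N} => monomial a) => u.
  by exists (fun a : 'X_{1..n < N} => cps_val u a); apply: truncation_ord.
Qed.

End ConvergentFiltration.

(** * Ideals, regular sequences and chains of primes *)

Section Ideals.
Variable A : comPzRingType.
Implicit Types (J I P : ideal A) (u v z : A) (s : seq A).

Lemma ideal_ext J I : (forall u, J u <-> I u) -> J = I.
Proof.
case: J I => [j j0 jD jM] [i i0 iD iM] /= ji.
have E : j = i by apply: funext => u; apply/propext/ji.
rewrite -E in i0 iD iM *.
by rewrite (Prop_irrelevance i0 j0) (Prop_irrelevance iD jD) (Prop_irrelevance iM jM).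
Qed.

Section Adjoin.
Variables (J : ideal A) (z : A).

(** The set [J + (z)], in a form that exhibits the coefficient of [z]. *)
Definition adj_set : set A := [set u | exists a, J (u - a * z)].

Lemma adj_set0 : adj_set 0.
Proof. by exists 0; rewrite mul0r subr0; apply: ideal0. Qed.

Lemma adj_setD u v : adj_set u -> adj_set v -> adj_set (u + v).
Proof.
move=> [a Ja] [b Jb]; exists (a + b).
by rewrite mulrDl opprD addrACA; apply: idealD.
Qed.

Lemma adj_setM a u : adj_set u -> adj_set (a * u).
Proof. by move=> [b Jb]; exists (a * b); rewrite -mulrA -mulrBr; apply: idealM. Qed.

Definition adj : ideal A := Ideal adj_set0 adj_setD adj_setM.

Lemma sub_adj u : J u -> adj u.
Proof. by exists 0; rewrite mul0r subr0. Qed.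

Lemma mem_adj : adj z.
Proof. by exists 1; rewrite mul1r subrr; apply: ideal0. Qed.

End Adjoin.

Section Colon.
Variables (J : ideal A) (v : A).

(** The ideal quotient [(J : v)], which is the annihilator of [v] modulo [J]. *)
Definition colon_set : set A := [set u | J (u * v)].

Lemma colon_set0 : colon_set 0.
Proof. by rewrite /colon_set /= mul0r; apply: ideal0. Qed.

Lemma colon_setD u w : colon_set u -> colon_set w -> colon_set (u + w).
Proof. by move=> Ju Jw; rewrite /colon_set /= mulrDl; apply: idealD. Qed.

Lemma colon_setM a u : colon_set u -> colon_set (a * u).
Proof. by move=> Ju; rewrite /colon_set /= -mulrA; apply: idealM. Qed.

Definition colon : ideal A := Ideal colon_set0 colon_setD colon_setM.

End Colon.

Lemma colon1 J : colon J 1 = J.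
Proof. by apply: ideal_ext => u /=; rewrite /colon_set /= mulr1. Qed.

Fixpoint adjs J s : ideal A := if s is z :: s' then adjs (adj J z) s' else J.

Lemma adjs_cat J s t : adjs J (s ++ t) = adjs (adjs J s) t.
Proof. by elim: s J => //= z s IH J; rewrite IH. Qed.

Lemma sub_adjs J s u : J u -> adjs J s u.
Proof. by elim: s J => //= z s IH J Ju; apply/IH/sub_adj. Qed.

Lemma mem_adjs J s z : z \in s -> adjs J s z.
Proof.
elim: s J => //= y s IH J; rewrite in_cons => /orP[/eqP->|/IH//].
exact/sub_adjs/mem_adj.
Qed.

Lemma adj_le J I z : (forall u, J u -> I u) -> I z -> forall u, adj J z u -> I u.
Proof.
by move=> JI Iz u [a /JI Iu]; rewrite -(subrK (a * z) u); apply: idealD => //; apply: idealM.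
Qed.

Lemma adjs_le J I s : (forall u, J u -> I u) -> (forall z, z \in s -> I z) ->
  forall u, adjs J s u -> I u.
Proof.
elim: s J => //= z s IH J JI sI; apply: IH => [u|y ys].
  by apply: adj_le => //; apply: sI; rewrite mem_head.
by apply: sI; rewrite in_cons ys orbT.
Qed.

Lemma adjC J z w : adj (adj J z) w = adj (adj J w) z.
Proof.
suff sub x y u : adj (adj J x) y u -> adj (adj J y) x u.
  by apply: ideal_ext => u; split; apply: sub.
apply: adj_le; last by apply/sub_adj/mem_adj.
by apply: adj_le => [v Jv|]; [do 2!apply: sub_adj | apply: mem_adj].
Qed.

Definition nzd J z := forall u, J (z * u) -> J u.

(** Regular sequences modulo [J], without the usual condition that [J + (s)] be proper. *)
Fixpoint reg J s : Prop := if s is z :: s' then nzd J z /\ reg (adj J z) s' else True.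

Lemma reg_cat J s t : reg J (s ++ t) <-> reg J s /\ reg (adjs J s) t.
Proof.
elim: s J => [|z s IH] J /=; first by split=> [|[]].
by rewrite IH; split=> [[? []]|[[]]].
Qed.

(** The next prime contains some ideal [J'] strictly above [P], which need not be prime itself; in
    [prime_chain_reg] it is an annihilator. *)
Fixpoint prime_chain_above (d : nat) J : Prop :=
  exists P, [/\ prime_ideal P, forall u, J u -> P u &
  if d is d'.+1 then
    exists J', [/\ forall u, P u -> J' u, exists2 u, J' u & ~ P u &
                prime_chain_above d' J']
  else True].

End Ideals.

(** * Noetherian arguments, associated primes and regular sequences *)

Section AdicAlgebra.
Variables (K : numFieldType) (A : comAlgType K) (O : nat -> ideal A).
Hypothesis adicO : adic_filtration O.
Implicit Types (J I P : ideal A) (u v w z : A) (s : seq A).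

Lemma ord_le M N u : (M <= N)%N -> O N u -> O M u.
Proof.
elim: N => [|N IH]; first by rewrite leqn0 => /eqP->.
by rewrite leq_eqVlt => /orP[/eqP->//|/IH MN /(adicS adicO)/MN].
Qed.

Lemma ordX z t : O 1%N z -> O t (z ^+ t).
Proof.
move=> z1; elim: t => [|t IH]; first exact: (adic0 adicO).
by rewrite exprS -add1n; apply: (adicM adicO).
Qed.

Lemma fingen J : exists r (h : 'I_r -> A), (forall i, J (h i)) /\
  forall u, J u -> exists q, u = \sum_i q i * h i.
Proof.
have [r [h [c [Jh AR]]]] := artin_rees adicO J; exists r, h; split=> // u Ju.
by have [q _ ->] := AR 0%N u Ju (adic0 adicO u); exists q.
Qed.

(** Counterexamples would form a strictly increasing sequence of ideals, but the generators of its
    union already lie in one member. *)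
Lemma noetherian_ind (Q : ideal A -> Prop) :
  (forall J, (forall I, (forall u, J u -> I u) -> (exists2 u, I u & ~ J u) -> Q I) -> Q J) ->
  forall J, Q J.
Proof.
move=> step J0; apply: contrapT => nQ0.
pose T := {J : ideal A | ~ Q J}.
have /choice[next nextP] : forall x : T, exists y : T,
    (forall u, sval x u -> sval y u) /\ exists2 u, sval y u & ~ sval x u.
  move=> [J nQ]; apply: contrapT => ny; apply/nQ/step => I JI Iu.
  by apply: contrapT => nQI; apply: ny; exists (exist _ I nQI).
pose sq i := iter i next (exist _ J0 nQ0 : T).
have sqS i u : sval (sq i) u -> sval (sq i.+1) u by have [+ _] := nextP (sq i); apply.
have sq_le i j u : (i <= j)%N -> sval (sq i) u -> sval (sq j) u.
  elim: j => [|j IH]; first by rewrite leqn0 => /eqP->.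
  by rewrite leq_eqVlt => /orP[/eqP->//|/IH ij /ij/sqS].
pose U := [set u | exists i, sval (sq i) u].
have U0 : U 0 by exists 0%N; apply: ideal0.
have UD u v : U u -> U v -> U (u + v).
  move=> [i ui] [j vj]; exists (maxn i j).
  by apply: idealD; [apply: sq_le ui | apply: sq_le vj]; rewrite ?leq_maxl ?leq_maxr.
have UM a u : U u -> U (a * u) by move=> [i ui]; exists i; apply: idealM.
have [r [h [/choice[k hk] gen]]] := fingen (Ideal U0 UD UM).
pose m := \max_i k i.
have [_ [u Su nSu]] := nextP (sq m).
have [|q uE] := gen u; first by exists m.+1.
apply: nSu; rewrite uE; apply: ideal_sum => i _; apply: idealM.
exact: sq_le (leq_bigmax i) (hk i).
Qed.

(** If [a * b] annihilates [u] modulo [J] but neither factor does, passing to [b * u] enlarges the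
    annihilator by [a]; noetherian induction ends at a prime. *)
Lemma colon_prime J u : ~ J u -> exists v,
  [/\ ~ J v, forall a, colon J u a -> colon J v a & prime_ideal (colon J v)].
Proof.
move: {2}(colon J u) (erefl (colon J u)) => I; elim/noetherian_ind: I u => I IH u EI nJu.
have [Pr|nPr] := pselect (prime_ideal (colon J u)); first by exists u.
have [a [b [Jab nJa nJb]]] : exists a b,
    [/\ colon J u (a * b), ~ colon J u a & ~ colon J u b].
  apply: contrapT => nab; apply: nPr; split; first by rewrite /= /colon_set /= mul1r.
  move=> a b Jab; have [|nJa] := pselect (colon J u a); first by left.
  by right; apply: contrapT => nJb; apply: nab; exists a, b.
have sub c : colon J u c -> colon J (b * u) c.
  by rewrite /= /colon_set /= mulrCA => Jc; apply: idealM.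
have [|||v [nJv subv prv]] := IH (colon J (b * u)) _ _ (b * u) erefl.
- by move=> c; rewrite -EI; apply: sub.
- by exists a; [rewrite /= /colon_set /= mulrA | rewrite -EI].
- exact: nJb.
by exists v; split=> // c /sub/subv.
Qed.

Lemma closed_pow J z u : O 1%N z ->
  (forall t, exists v, J (u - z ^+ t * v)) -> J u.
Proof.
move=> z1 Jz; apply: (adic_closed adicO) => t; have [v Jv] := Jz t.
exists (u - z ^+ t * v), (z ^+ t * v); split; rewrite ?subrK //.
by rewrite mulrC; apply/idealM/ordX.
Qed.

(** For the first claim: if [w * u] lies in [J], then [u] is, modulo [J], a multiple of [z] by an
    element again killed by [w]. Iterating, [u] lies in [J + (z^t)] for all [t], hence in the closed
    ideal [J]. *)
Lemma nzd_swap J z w : O 1%N z -> nzd J z -> nzd (adj J z) w ->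
  nzd J w /\ nzd (adj J w) z.
Proof.
move=> z1 Jz Jzw.
have divz u : J (w * u) -> exists2 u', J (u - z * u') & J (w * u').
  move=> Ju; have [a Ja] := Jzw u (sub_adj _ Ju); exists a; first by rewrite mulrC.
  apply: Jz; rewrite (_ : z * _ = w * u - w * (u - a * z)); last by ring.
  by apply: idealB => //; apply: idealM.
have nJw : nzd J w.
  move=> u Ju; apply: (closed_pow z1) => t.
  suff [v Jv _] : exists2 v, J (u - z ^+ t * v) & J (w * v) by exists v.
  elim: t => [|t [v Jv Jwv]]; first by exists u; rewrite // expr0 mul1r subrr; apply: ideal0.
  have [v' Jv' Jwv'] := divz v Jwv; exists v' => //.
  rewrite (_ : _ - _ = (u - z ^+ t * v) + z ^+ t * (v - z * v')); last first.
    by rewrite exprS; ring.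
  by apply: idealD => //; apply: idealM.
split=> // u [v Jv].
have [v' Jv'] : adj J z v.
  apply: Jzw; exists u; rewrite (_ : _ - _ = - (z * u - v * w)); last by ring.
  by rewrite -mulN1r; apply: idealM.
exists v'; apply: Jz.
rewrite (_ : _ * _ = (z * u - v * w) + w * (v - v' * z)); last by ring.
by apply: idealD => //; apply: idealM.
Qed.

(* Every associated prime of a quotient by a regular sequence of length [d]
   starts a chain of primes of length [d]: dividing a witness [u] by [z] as
   often as possible makes it survive modulo [J + (z)], where its annihilator
   also contains [z]. *)
Lemma prime_chain_reg s J u : (forall z, z \in s -> O 1%N z) -> reg J s -> ~ J u ->
  prime_chain_above (size s) (colon J u).
Proof.
elim: s J u => [|z s IH] J u sO /=.
  by move=> _ /colon_prime[v [_ uv vp]]; exists (colon J v).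
move=> [Jz regs] /colon_prime[v [nJv uv vp]].
have z1 : O 1%N z by apply: sO; rewrite mem_head.
have [v' [nJv' vv']] : exists v', ~ adj J z v' /\ forall a, colon J v' a <-> colon J v a.
  apply: contrapT => nv'; apply: nJv; apply: (closed_pow z1) => t.
  suff [y Jy _] : exists2 y, J (v - z ^+ t * y) & forall a, colon J y a <-> colon J v a.
    by exists y.
  elim: t => [|t [y Jy yv]]; first by exists v; rewrite // expr0 mul1r subrr; apply: ideal0.
  have [y' Jy'] : adj J z y by apply: contrapT => ny; apply: nv'; exists y.
  exists y' => [|a].
    rewrite (_ : _ - _ = (v - z ^+ t * y) + z ^+ t * (y - y' * z)); last first.
      by rewrite exprS; ring.
    by apply: idealD => //; apply: idealM.
  rewrite -yv /= /colon_set /=; split=> Ja.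
    rewrite (_ : a * y = a * (y - y' * z) + z * (a * y')); last by ring.
    by apply: idealD; apply: idealM.
  apply: Jz; rewrite (_ : z * _ = a * y - a * (y - y' * z)); last by ring.
  by apply: idealB => //; apply: idealM.
exists (colon J v); split=> //; exists (colon (adj J z) v'); split.
- by move=> a /vv' Ja; apply: sub_adj.
- exists z; first by exists v'; rewrite mulrC subrr; apply: ideal0.
  by move=> /vv'/Jz /sub_adj-/(_ z).
- by apply: IH => // y ys; apply: sO; rewrite in_cons ys orbT.
Qed.

End AdicAlgebra.

(** * Codimensions and growth of Hilbert functions *)

Section RelativeDimension.
Variables (K : numFieldType) (A : comAlgType K).
Implicit Types (U V W J : ideal A) (u v f : A).

Definition spans_mod V W d (u : 'I_d -> A) := (forall i, V (u i)) /\
  forall a, V a -> exists c : 'I_d -> K, W (a - \sum_i c i *: u i).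

Definition free_mod W d (u : 'I_d -> A) :=
  forall c : 'I_d -> K, W (\sum_i c i *: u i) -> forall i, c i = 0.

(** The dimension of [(V + W) / W], hence of [V / W] when [W] lies in [V], expressed by
    representatives of a basis. *)
Definition reldim V W d := exists2 u : 'I_d -> A, spans_mod V W u & free_mod W u.

Lemma free_spans_le V W d e (u : 'I_d -> A) (v : 'I_e -> A) :
  spans_mod V W u -> (forall k, V (v k)) -> free_mod W v -> (e <= d)%N.
Proof.
move=> [_ uV] vV vW; have /choice[c cP] k := uV _ (vV k).
rewrite leqNgt; apply/negP => lt_de.
pose C := \matrix_(k < e, i < d) c k i.
have : kermx C != 0.
  by rewrite kermx_eq0 /row_free neq_ltn (leq_ltn_trans (rank_leq_col C)).
case/rowV0Pn => x /sub_kermxP xC /eqP x0; apply: x0; apply/rowP => k; rewrite mxE.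
apply: (vW (fun k => x 0 k)); rewrite (_ : \sum_k _ =
  \sum_k x 0 k *: (v k - \sum_i c k i *: u i)); first by apply: ideal_sum => j _; apply: idealZ.
under [RHS]eq_bigr do rewrite scalerBr.
rewrite sumrB [X in _ - X](_ : _ = 0) ?subr0 //.
under eq_bigr do rewrite scaler_sumr.
rewrite exchange_big big1 // => i _; move/rowP/(_ i): xC; rewrite !mxE => xC.
under eq_bigr do rewrite scalerA.
rewrite -scaler_suml; under eq_bigr do rewrite -[c _ i](mxE matrix_key (fun k i => c k i)).
by rewrite xC scale0r.
Qed.

Lemma reldim_unique V W d e : reldim V W d -> reldim V W e -> d = e.
Proof.
move=> [u us uf] [v vs vf]; apply/eqP; rewrite eqn_leq.
by rewrite (free_spans_le vs us.1 uf) (free_spans_le us vs.1 vf).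
Qed.

Lemma spans_reldim V W r (u : 'I_r -> A) : spans_mod V W u -> exists d, reldim V W d.
Proof.
elim: r u => [|r IH] u us; first by exists 0%N, u => // c _ [].
have [uf|] := pselect (free_mod W u); first by exists r.+1, u.
move=> /existsNP[c /not_implyP[Wc /existsNP[i /eqP ci]]].
apply: (IH (fun k => u (lift i k))); split=> [k|a]; first exact: us.1.
move=> /us.2[b Wb]; exists (fun k => b (lift i k) - b i / c i * c (lift i k)).
have := idealB Wb (idealZ (- (b i / c i)) Wc); congr (ideal_set W _).
rewrite scaleNr opprK -addrA; congr (_ + _).
rewrite (bigD1_ord i) //= [X in _ / _ *: X](bigD1_ord i) //= scalerDr scalerA divfK //.
rewrite opprD addrACA addNr add0r scaler_sumr -!sumrN -big_split /=.
by apply: eq_bigr => k _; rewrite scalerBl opprB addrC scalerA.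
Qed.

Lemma reldim_trans U V W d1 d2 : (forall a, V a -> U a) -> (forall a, W a -> V a) ->
  reldim U V d1 -> reldim V W d2 -> reldim U W (d1 + d2).
Proof.
move=> VU WV [u us uf] [v vs vf].
pose g (F : 'I_d1 -> A) (G : 'I_d2 -> A) i := match split i with inl j => F j | inr k => G k end.
have gl F G j : g F G (lshift d2 j) = F j by rewrite /g -[lshift d2 j]/(unsplit (inl j)) unsplitK.
have gr F G k : g F G (rshift d1 k) = G k by rewrite /g -[rshift d1 k]/(unsplit (inr k)) unsplitK.
exists (g u v).
  split=> [i|a Ua]; first by rewrite /g; case: (split i) => j; [apply: us.1 | apply/VU/vs.1].
  have [c Vc] := us.2 a Ua; have [b Wb] := vs.2 _ Vc.
  exists (fun i => match split i with inl j => c j | inr k => b k end).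
  move: Wb; congr (ideal_set W _); rewrite big_split_ord opprD addrA.
  congr (_ - _ - _); apply: eq_bigr => j _; rewrite ?gl ?gr.
    by rewrite -[lshift d2 j]/(unsplit (inl j)) unsplitK.
  by rewrite -[rshift d1 j]/(unsplit (inr j)) unsplitK.
move=> c; rewrite big_split_ord /=.
under eq_bigr do rewrite gl; under [X in _ + X]eq_bigr do rewrite gr.
move=> Wc.
have Vv : V (\sum_(k < d2) c (rshift d1 k) *: v k).
  by apply: ideal_sum => k _; apply/idealZ/vs.1.
have c1 : forall j, c (lshift d2 j) = 0.
  by apply: uf; rewrite -[X in ideal_set V X](addrK (\sum_(k < d2) c (rshift d1 k) *: v k));
     apply: idealB => //; apply: WV.
have c2 : forall k, c (rshift d1 k) = 0.
  apply: vf; move: Wc; rewrite [X in X + _]big1 ?add0r // => j _.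
  by rewrite c1 scale0r.
by move=> i; case: (splitP i) => k ik; [rewrite -(c1 k) | rewrite -(c2 k)];
   congr c; apply: val_inj.
Qed.

Definition top_ideal : ideal A :=
  @Ideal A (fun=> True) I (fun _ _ _ _ => I) (fun _ _ _ => I).

Definition codim W d := reldim top_ideal W d.

Lemma codim_le W V d e : (forall u, W u -> V u) -> codim W d -> codim V e -> (e <= d)%N.
Proof.
move=> WV [u us _] [v _ vf].
by apply: (free_spans_le us (v := v)) => // c Wc; apply: vf; apply: WV.
Qed.

Lemma codim_gt0 W d : ~ W 1 -> codim W d -> (0 < d)%N.
Proof.
case: d => // nW [u [_ us] _]; case: nW; have [c] := us 1 I.
by rewrite big_ord0 subr0.
Qed.

(** Multiplication by [f] embeds [A / (J : f)] in [A / J] with cokernel [A / (J + (f))]. *)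
Lemma codim_adj_colon J f d1 d2 :
  codim (adj J f) d1 -> codim (colon J f) d2 -> codim J (d1 + d2).
Proof.
move=> J1 [v vs vf]; apply: reldim_trans J1 _ => // [a|]; first exact: sub_adj.
exists (fun i => v i * f).
  split=> [i|a [b Jb]]; first by apply/idealM/mem_adj.
  have [c Jc] := vs.2 b I; exists c; have := idealD Jb Jc; congr (ideal_set J _).
  rewrite mulrBl mulr_suml addrA subrK; congr (_ - _).
  by apply: eq_bigr => i _; rewrite scalerAl.
move=> c Jc; apply: vf; move: Jc; congr (ideal_set J _); rewrite mulr_suml.
by apply: eq_bigr => i _; rewrite scalerAl.
Qed.

End RelativeDimension.

Lemma leq_exp_weak m p e : (m <= p)%N -> (m ^ e <= p ^ e)%N.
Proof. by case: e => // e mp; rewrite leq_exp2r. Qed.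

(** If [s < d], taking [t = d + m + 1] gives [(m + 1)^(s + 1) <= X (m + 1)^s] with [X] independent
    of [m], which fails at [m = X]. *)
Lemma bin_growth d s C c : (forall t, 'C(t, d) <= C * (c * t).+2 ^ s)%N -> (d <= s)%N.
Proof.
move=> H; rewrite leqNgt; apply/negP => lt_sd.
have pow_ffact m : (m ^ d <= (d + m) ^_ d)%N.
  rewrite ffact_prod -[X in (m ^ X)%N]card_ord -prod_nat_const.
  by apply: leq_prod => i _; have := ltn_ord i; lia.
pose X := (d`! * C * (c * d.+1).+2 ^ s)%N.
have bound m : (m.+1 ^ s.+1 <= X * m.+1 ^ s)%N.
  apply: (@leq_trans (m.+1 ^ d)); first by rewrite leq_pexp2l.
  apply: leq_trans (pow_ffact _) _; rewrite -bin_ffact mulnC /X -!mulnA leq_mul2l.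
  apply/orP; right; apply: leq_trans (H _) _; rewrite leq_mul2l -expnMn.
  by apply/orP; right; apply: leq_exp_weak; nia.
have := bound X; rewrite expnS leq_pmul2r ?expn_gt0 // ltnn //.
Qed.

(** * Hilbert functions and lengths of chains of primes *)

Section HilbertGrowth.
Variables (K : numFieldType) (A : comAlgType K) (O : nat -> ideal A).
Hypothesis adicO : adic_filtration O.
Implicit Types (J I P : ideal A) (u v w z : A) (s : seq A).

Lemma add_subl J I u : J u -> ideal_add J I u.
Proof. by move=> Ju; exists u, 0; split; rewrite ?addr0 //; apply: ideal0. Qed.

Lemma add_subr J I u : I u -> ideal_add J I u.
Proof. by move=> Iu; exists 0, u; split; rewrite ?add0r //; apply: ideal0. Qed.

Lemma add_le J I P : (forall u, J u -> P u) -> (forall u, I u -> P u) ->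
  forall u, ideal_add J I u -> P u.
Proof. by move=> JP IP u [v [w [/JP Pv /IP Pw ->]]]; apply: idealD. Qed.

Lemma codim_exists J N : (forall u, O N u -> J u) -> exists d, codim J d.
Proof.
move=> NJ; have [I [b bP]] := adic_findim adicO N.
apply: (spans_reldim (u := fun i : 'I_#|I| => b (enum_val i))); split=> // a _.
have [c /NJ Jc] := bP a; exists (fun i => c (enum_val i)).
move: Jc; congr (ideal_set J (_ - _)).
by rewrite (reindex (@enum_val I xpredT)) //=; apply/onW_bij/enum_val_bij.
Qed.

(** For convergent power series, [hdim J N.+1] is the value of [H_J] at [N]. The default 0 is never
    a substitute for a missing dimension, by [hdimP]. *)
Definition hdim J N : nat := xget 0%N [set d | codim (ideal_add J (O N)) d].

Lemma hdimP J N : codim (ideal_add J (O N)) (hdim J N).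
Proof.
rewrite /hdim; case: xgetP => // /= nd.
by have [d /nd] := codim_exists (@add_subr J (O N)).
Qed.

Lemma hdim_le J I M N : (forall u, J u -> I u) -> (N <= M)%N ->
  (hdim I N <= hdim J M)%N.
Proof.
move=> JI NM; apply: codim_le (hdimP J M) (hdimP I N).
apply: add_le => u; first by move=> /JI; apply: add_subl.
by move=> /(ord_le adicO NM); apply: add_subr.
Qed.

Lemma hdim_adj_colon J z N : exists2 e, codim (colon (ideal_add J (O N)) z) e &
  hdim J N = (hdim (adj J z) N + e)%N.
Proof.
have [|e eP] := @codim_exists (colon (ideal_add J (O N)) z) N.
  by move=> u Nu; rewrite /= /colon_set /= mulrC; apply/add_subr/idealM.
exists e => //; apply: reldim_unique (hdimP J N) _; apply: codim_adj_colon eP.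
have -> : adj (ideal_add J (O N)) z = ideal_add (adj J z) (O N); last exact: hdimP.
apply: ideal_ext => u; split.
  apply: adj_le; last exact/add_subl/mem_adj.
  by apply: add_le => v Jv; [apply/add_subl/sub_adj | apply: add_subr].
apply: add_le => v; last by move=> Nv; apply/sub_adj/add_subr.
apply: adj_le; last exact: mem_adj.
by move=> w Jw; apply/sub_adj/add_subl.
Qed.

(** As [z] has order at least one, [(J + O N.+1 : z)] contains [J + O N]. *)
Lemma hdim_adj_ge J z N : O 1%N z ->
  (hdim J N.+1 <= hdim (adj J z) N.+1 + hdim J N)%N.
Proof.
move=> z1; have [e eP ->] := hdim_adj_colon J z N.+1.
rewrite leq_add2l; apply: codim_le (hdimP J N) eP.
apply: add_le => u; first by move=> Ju; rewrite /= /colon_set /= mulrC; apply/add_subl/idealM.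
by move=> Nu; rewrite /= /colon_set /= mulrC; apply: add_subr; rewrite -add1n; apply: (adicM adicO).
Qed.

(** By Artin-Rees for [J + (z)], its element [w] of order [N] is a combination of fixed generators
    [h i] with coefficients of order [N - c]. Each [h i] is a multiple of [z] modulo [J], and [z]
    can be cancelled. *)
Lemma nzd_ord J z : nzd J z -> exists c, forall N u,
  ideal_add J (O N) (z * u) -> ideal_add J (O (N - c)%N) u.
Proof.
move=> Jz; have [r [h [c [hJ AR]]]] := artin_rees adicO (adj J z).
exists c => N u [v [w [Jv Nw E]]].
have /choice[a aP] : forall i, exists a, J (h i - a * z) by move=> i; apply: hJ.
have [|q qN wE] := AR N w _ Nw.
  exists u; rewrite (_ : _ - _ = - v); last by rewrite mulrC E; ring.
  by rewrite -mulN1r; apply: idealM.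
exists (u - \sum_i q i * a i), (\sum_i q i * a i); split; rewrite ?subrK //.
  apply: Jz; rewrite mulrBr E wE mulr_sumr -addrA -sumrB.
  apply: idealD => //; apply: ideal_sum => i _.
  rewrite (_ : _ - _ = q i * (h i - a i * z)); last by ring.
  exact: idealM.
by apply: ideal_sum => i _; rewrite mulrC; apply: idealM.
Qed.

Lemma nzd_prime P z : prime_ideal P -> ~ P z -> nzd P z.
Proof. by move=> [_ Pp] nPz u /Pp[]. Qed.

(** By [nzd_ord], [(P + O N : z)] lies in [P + O (N - c)]. *)
Lemma hdim_prime_ge P I z : prime_ideal P -> ~ P z -> (forall u, adj P z u -> I u) ->
  exists c, forall N, (hdim I N + hdim P (N - c) <= hdim P N)%N.
Proof.
move=> Pp nPz PI; have [c cP] := nzd_ord (nzd_prime Pp nPz).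
exists c => N; have [e eP ->] := hdim_adj_colon P z N.
apply: leq_add; first exact: hdim_le.
apply: codim_le eP (hdimP P _) => u; rewrite /= /colon_set /= mulrC; exact: cP.
Qed.

Lemma local_sub J u : ~ J 1 -> J u -> O 1%N u.
Proof.
move=> nJ Ju; have [//|[v vu]] := adic_unit adicO u.
by case: nJ; rewrite -vu; apply: idealM.
Qed.

Lemma hdim_gt0 J N : ~ J 1 -> (0 < hdim J N.+1)%N.
Proof.
move=> nJ; apply: codim_gt0 (hdimP _ _) => J1; apply: (adic_proper adicO).
apply: add_le J1 => u; first exact: local_sub.
exact: ord_le.
Qed.

(** Advancing the argument by a constant [c] turns [hdim_prime_ge] into Pascal's rule for binomial
    coefficients. *)
Lemma hdim_chain_ge d J : prime_chain_above d J ->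
  exists c, forall t, ('C(t, d) <= hdim J (c * t).+1)%N.
Proof.
elim: d J => [|d IH] J /= [P [Pp JP]].
  move=> _; exists 0%N => t; rewrite bin0.
  exact: leq_trans (hdim_gt0 _ Pp.1) (hdim_le JP (leqnn _)).
move=> [I [PI [z Iz nPz] /IH[c1 c1P]]].
have [c2 c2P] := hdim_prime_ge Pp nPz (adj_le PI Iz).
exists (maxn c1 c2) => t; apply: (leq_trans _ (hdim_le JP (leqnn (maxn c1 c2 * t).+1))).
elim: t => [|t IHt] //; rewrite binS addnC.
apply: leq_trans (c2P _); apply: leq_add.
  apply: (@leq_trans 'C(t.+1, d)); first exact: leq_bin2l.
  apply: leq_trans (c1P _) (hdim_le _ _) => //.
  by rewrite ltnS leq_mul2r leq_maxl orbT.
apply: leq_trans IHt (hdim_le _ _) => //.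
by have := leq_maxr c1 c2; nia.
Qed.

(** The ideal is primary to the maximal ideal [O 1], or is the unit ideal. *)
Definition mprimary J := exists N, forall u, O N u -> J u.

(** Summing [hdim_adj_ge] over [N] raises the degree of growth by one for each parameter. *)
Lemma hdim_adjs_le J s : (forall z, z \in s -> O 1%N z) -> mprimary (adjs J s) ->
  exists C, forall N, (hdim J N <= C * N.+1 ^ size s)%N.
Proof.
elim: s J => [|z s IH] J sO /=.
  move=> [M MJ]; exists (hdim J M) => N; rewrite muln1.
  apply: codim_le (hdimP J M) (hdimP J N); apply: add_le => u; last by move=> /MJ/add_subl.
  exact: add_subl.
move=> Js; have [|C CP] := IH (adj J z) _ Js.
  by move=> y ys; apply: sO; rewrite in_cons ys orbT.
exists (C + hdim J 0)%N; elim=> [|N IHN]; first by rewrite exp1n muln1 leq_addl.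
have z1 : O 1%N z by apply: sO; rewrite mem_head.
apply: leq_trans (hdim_adj_ge J N z1) _.
have le_pow : (N.+1 ^ (size s).+1 <= N.+1 * N.+2 ^ size s)%N.
  by rewrite expnS leq_mul2l leq_exp_weak ?orbT.
have := CP N.+1; rewrite [(N.+2 ^ (size s).+1)%N]expnS => leC.
move: IHN le_pow leC; move: (N.+1 ^ _)%N (N.+2 ^ _)%N => p q; nia.
Qed.


(** A chain forces growth of degree at least [d], while the parameters allow at most degree
    [size s]. *)
Lemma prime_chain_above_le d J s : (forall z, z \in s -> O 1%N z) ->
  mprimary (adjs J s) -> prime_chain_above d J -> (d <= size s)%N.
Proof.
move=> sO /(hdim_adjs_le sO)[C CP] /hdim_chain_ge[c cP].
by apply: (@bin_growth d (size s) C c) => t; apply: leq_trans (cP t) (CP _).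
Qed.

End HilbertGrowth.

(** * Systems of parameters *)

Section SystemsOfParameters.
Variables (K : numFieldType) (A : comAlgType K) (O : nat -> ideal A).
Hypothesis adicO : adic_filtration O.
Implicit Types (J P Q : ideal A) (u v w z : A) (s : seq A).
Local Notation mprimary := (mprimary O).

Lemma not_prime_split J : ~ J 1 -> ~ prime_ideal J ->
  exists a b, [/\ J (a * b), ~ J a & ~ J b].
Proof.
move=> nJ nP; apply: contrapT => nab; apply: nP; split=> // a b Jab.
have [|nJa] := pselect (J a); first by left.
by right; apply: contrapT => nJb; apply: nab; exists a, b.
Qed.

Lemma prime_ord1 : prime_ideal (O 1%N).
Proof.
split=> [|u v Ouv]; first exact: adic_proper.
have [|[w wu]] := adic_unit adicO u; first by left.
by right; rewrite -[v]mul1r -wu -mulrA; apply: idealM.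
Qed.

(** Noetherian induction: if [a * b] lies in [J], the product of [J + (a)] and [J + (b)] lies in
    [J], so [adic_prod] applies. *)
Lemma mprimary_of_primes J :
  (forall P, prime_ideal P -> (forall u, J u -> P u) -> forall u, O 1%N u -> P u) ->
  mprimary J.
Proof.
elim/(noetherian_ind adicO): J => J IH Jm.
have [J1|nJ1] := pselect (J 1).
  by exists 0%N => u _; rewrite -[u]mulr1; apply: idealM.
have [Jp|/(not_prime_split nJ1)[a [b [Jab nJa nJb]]]] := pselect (prime_ideal J).
  by exists 1%N; apply: Jm.
have sub c : ~ J c -> mprimary (adj J c).
  move=> nJc; apply: IH => [u||P Pp JP]; [exact: sub_adj | by exists c; first exact: mem_adj |].
  by apply: Jm => // u Ju; apply/JP/sub_adj.
have [M MJ] := sub a nJa; have [N NJ] := sub b nJb.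
exists (M + N)%N; apply: (adic_prod adicO) => u v /MJ[x Jx] /NJ[y Jy].
rewrite (_ : u * v = v * (u - x * a) + x * a * (v - y * b) + x * y * (a * b)); last by ring.
by apply: idealD; [apply: idealD|]; apply: idealM.
Qed.

Lemma nonmaximal_minimal_primes J : exists (I : finType) (P : I -> ideal A),
  [/\ forall i, prime_ideal (P i) /\ exists2 u, O 1%N u & ~ P i u,
      forall i u, J u -> P i u &
      forall Q, prime_ideal Q -> (forall u, J u -> Q u) ->
        (forall u, O 1%N u -> Q u) \/ exists i, forall u, P i u -> Q u].
Proof.
elim/(noetherian_ind adicO): J => J IH.
have [J1|nJ1] := pselect (J 1).
  by exists 'I_0, (fun=> J); split=> [[]|[]|Q [nQ _] JQ] //; case: nQ; apply: JQ.
have [Jp|/(not_prime_split nJ1)[a [b [Jab nJa nJb]]]] := pselect (prime_ideal J).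
  have [mJ|nmJ] := pselect (forall u, O 1%N u -> J u).
    by exists 'I_0, (fun=> J); split=> [[]|[]|Q _ JQ] //; left=> u /mJ/JQ.
  exists unit, (fun=> J); split=> // [_|Q _ JQ]; last by right; exists tt.
  by split=> //; have /existsNP[u /not_implyP[]] := nmJ; exists u.
have ltJ c : ~ J c -> exists2 u, adj J c u & ~ J u by exists c; first exact: mem_adj.
have [I1 [P1 [P1p JP1 P1P]]] := IH (adj J a) (@sub_adj _ J a) (ltJ a nJa).
have [I2 [P2 [P2p JP2 P2P]]] := IH (adj J b) (@sub_adj _ J b) (ltJ b nJb).
exists (I1 + I2)%type, (fun i => match i with inl i => P1 i | inr i => P2 i end).
split=> [[] //|[] i u Ju|Q Qp JQ]; [exact/JP1/sub_adj | exact/JP2/sub_adj |].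
have [Qa|Qb] := Qp.2 _ _ (JQ _ Jab).
  by have [?|[i PQ]] := P1P Q Qp (adj_le JQ Qa); [left | right; exists (inl i)].
by have [?|[i PQ]] := P2P Q Qp (adj_le JQ Qb); [left | right; exists (inr i)].
Qed.

(* Prime avoidance is easy here because [K] is infinite: on a line [w + t p]
   each prime is met at most once. *)
Lemma prime_avoidance (I : finType) (P : I -> ideal A) :
  (forall i, exists2 u, O 1%N u & ~ P i u) -> exists2 w, O 1%N w & forall i, ~ P i w.
Proof.
move=> nP; suff /(_ (enum I))[w w1 wP] : forall r : seq I,
    exists2 w, O 1%N w & forall i, i \in r -> ~ P i w.
  by exists w => // i; apply: wP; rewrite mem_enum.
elim=> [|i r [w w1 wP]]; first by exists 0 => //; apply: ideal0.
have [p p1 nPp] := nP i.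
have /choice[N NP] : forall j, exists N, j \in i :: r ->
    forall t, (N <= t)%N -> ~ P j (w + t%:R *: p).
  move=> j; have [[t0 Pt0]|nt] := pselect (exists t, P j (w + t%:R *: p)); last first.
    by exists 0%N => _ t _ Pt; apply: nt; exists t.
  exists t0.+1 => jr t lt_t Pt.
  have Pp : P j p.
    have := idealZ (t%:R - t0%:R)^-1 (idealB Pt Pt0).
    rewrite opprD addrACA subrr add0r -scalerBl scalerA mulVf ?scale1r //.
    by rewrite subr_eq0 eqr_nat gtn_eqF.
  move: jr; rewrite in_cons => /orP[/eqP ji|jr]; first by rewrite -ji in nPp.
  by case: (wP j jr); rewrite -(addrK (t%:R *: p) w); apply: idealB => //; apply: idealZ.
pose t := \max_j N j.
exists (w + t%:R *: p) => [|j jr]; first by apply: idealD => //; apply: idealZ.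
by apply: NP => //; apply: (leq_bigmax j).
Qed.

Lemma prime_chain_above_proper d J : prime_chain_above d J -> ~ J 1.
Proof. by case: d => [|d] [P [[nP _] JP _]] /JP. Qed.

(** The bottom prime [Q] of the chain contains [w], so it strictly contains some [P i], which
    prolongs the chain downwards. [Q] is not maximal because the chain has at least one step. *)
Lemma prime_chain_adj J (I : finType) (P : I -> ideal A) w :
  (forall i, prime_ideal (P i)) -> (forall i u, J u -> P i u) ->
  (forall Q, prime_ideal Q -> (forall u, J u -> Q u) ->
    (forall u, O 1%N u -> Q u) \/ exists i, forall u, P i u -> Q u) ->
  (forall i, ~ P i w) ->
  forall d, prime_chain_above d.+1 (adj J w) -> prime_chain_above d.+2 J.
Proof.
move=> Pp JP minP nPw d [Q [Qp JQ [J' [QJ' [z J'z nQz] chain]]]].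
have Qw : Q w by apply/JQ/mem_adj.
have [mQ|[i PQ]] := minP Q Qp (fun u Ju => JQ u (sub_adj w Ju)).
  have [/mQ//|[v vz]] := adic_unit adicO z.
  by case: (prime_chain_above_proper chain); rewrite -vz; apply: idealM.
exists (P i); split=> //; first exact: JP.
exists Q; split=> //; first by exists w.
by exists Q; split=> //; exists J'; split=> //; exists z.
Qed.

Definition dim_le J m := forall d, prime_chain_above d J -> (d <= m)%N.

(** One [w] avoids the primes of both families, so that the two dimensions drop together. *)
Lemma dim_le_adj2 J1 J2 m : dim_le J1 m.+1 -> dim_le J2 m.+1 ->
  exists w, [/\ O 1%N w, dim_le (adj J1 w) m & dim_le (adj J2 w) m].
Proof.
move=> J1m J2m.
have [I1 [P1 [P1p JP1 P1P]]] := nonmaximal_minimal_primes J1.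
have [I2 [P2 [P2p JP2 P2P]]] := nonmaximal_minimal_primes J2.
have [|w w1 wP] := @prime_avoidance (I1 + I2)%type
  (fun i => match i with inl i => P1 i | inr i => P2 i end).
  by case=> i; [case: (P1p i) | case: (P2p i)].
exists w; split=> // -[|d] // chain; rewrite -ltnS.
  apply/J1m/(prime_chain_adj (fun i => (P1p i).1) JP1 P1P _ chain) => i.
  exact: (wP (inl i)).
apply/J2m/(prime_chain_adj (fun i => (P2p i).1) JP2 P2P _ chain) => i.
exact: (wP (inr i)).
Qed.

Lemma exists_parameters m J : dim_le J m -> exists y : seq A,
  [/\ size y = m, forall z, z \in y -> O 1%N z & mprimary (adjs J y)].
Proof.
elim: m J => [|m IH] J Jm.
  exists [::]; split=> //; apply: mprimary_of_primes => P Pp JP u u1.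
  (* A prime over [J] that misses [u] would start a chain of one step ending at the maximal
     ideal. *)
  apply: contrapT => nPu; suff /Jm : prime_chain_above 1 J by [].
  exists P; split=> //; exists (O 1%N); split; last first.
  - by exists (O 1%N); split=> //; apply: prime_ord1.
  - by exists u.
  - by move=> v; apply: (local_sub adicO); case: Pp.
have [w [w1 wJ _]] := dim_le_adj2 Jm Jm.
have [y [ym y1 yJ]] := IH _ wJ.
exists (w :: y); split=> //=; first by rewrite ym.
by move=> z; rewrite in_cons => /orP[/eqP->|/y1].
Qed.

Lemma mprimary_dim_le J s : (forall z, z \in s -> O 1%N z) ->
  mprimary (adjs J s) -> dim_le J (size s).
Proof. by move=> s1 Js d; apply: (prime_chain_above_le adicO s1 Js). Qed.

(* The two systems are linked through a common parameter [w] of [J + (z1)] and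
   [J + (f1)]: the sequences [z1, w, ...] and [w, f1, ...] and [f1, w, ...] are
   successively seen to be regular. *)
Lemma parameters_reg J s t : size s = size t ->
  (forall z, z \in s -> O 1%N z) -> (forall z, z \in t -> O 1%N z) ->
  reg J s -> mprimary (adjs J s) -> mprimary (adjs J t) -> reg J t.
Proof.
move: {2}(size s) (erefl (size s)) => m; elim: m J s t => [|m IH] J s t ms.
  by move=> st; have -> : t = [::] by apply: size0nil; rewrite -st.
case: s ms => [//|z s] /= [ms]; case: t => [//|f t] /= [st] s1 t1 [Jz regs] Js Jt.
have z1 : O 1%N z by apply: s1; rewrite mem_head.
have f1 : O 1%N f by apply: t1; rewrite mem_head.
have {}s1 y : y \in s -> O 1%N y by move=> ys; apply: s1; rewrite in_cons ys orbT.
have {}t1 y : y \in t -> O 1%N y by move=> yt; apply: t1; rewrite in_cons yt orbT.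
case: m => [|m] in IH ms *.
  rewrite (size0nil ms) /= in Js; rewrite (size0nil (_ : size t = 0)%N) /= in Jt *; last by rewrite -st.
  (* With one parameter on each side, a power of [z] is a multiple of [f] modulo [J], so whatever
     [f] kills is killed by that power. *)
  split=> // u Jfu; have [M MJ] := Jt.
  have [a Ja] := MJ _ (ordX adicO M z1).
  suff JzM : J (z ^+ M * u).
    elim: M JzM {MJ Ja} => [|M IHM]; first by rewrite expr0 mul1r.
    by rewrite exprS -mulrA => /Jz/IHM.
  rewrite (_ : _ * u = u * (z ^+ M - a * f) + a * (f * u)); last by ring.
  by apply: idealD; apply: idealM.
have Jz_dim : dim_le (adj J z) m.+1 by rewrite -ms; apply: mprimary_dim_le.
have Jf_dim : dim_le (adj J f) m.+1 by rewrite -ms st; apply: mprimary_dim_le.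
have [w [w1 Jzw Jfw]] := dim_le_adj2 Jz_dim Jf_dim.
have [x [xm x1 Jx]] := exists_parameters Jzw.
have [y [ym y1 Jy]] := exists_parameters Jfw.
have cons1 a r : O 1%N a -> (forall b, b \in r -> O 1%N b) ->
    forall b, b \in a :: r -> O 1%N b.
  by move=> a1 r1 b; rewrite in_cons => /orP[/eqP->|/r1].
have [nzw regx] : reg (adj J z) (w :: x).
  by apply: (IH _ s) => //=; rewrite ?xm //; apply: cons1.
have [nw nwz] := nzd_swap adicO z1 Jz nzw.
have [nwf regy] : reg (adj J w) (f :: y).
  apply: (IH _ (z :: x)) => //=; rewrite ?xm ?ym //; try exact: cons1.
  - by split=> //; rewrite adjC.
  - by rewrite adjC.
  - by rewrite adjC.
have [nf nfw] := nzd_swap adicO w1 nw nwf.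
split=> //; apply: (IH _ (w :: y)) => //=; rewrite ?ym -?st //.
- exact: cons1.
- by split=> //; rewrite adjC.
Qed.

End SystemsOfParameters.

(** * Perturbation of a regular sequence *)

Section Perturbation.
Variables (K : numFieldType) (A : comAlgType K) (O : nat -> ideal A).
Hypothesis adicO : adic_filtration O.
Implicit Types (J : ideal A) (u v w z f g : A) (F G : seq A).

(** The precision [e] is relative to the order of [u]; already [e = 1] preserves initial forms. *)
Definition approx (e : nat) J J' := forall N u, J u -> O N u ->
  exists2 u', J' u' & O (N + e)%N (u - u').

Lemma approx_le d e J J' : (d <= e)%N -> approx e J J' -> approx d J J'.
Proof.
move=> de JJ' N u Ju Nu; have [u' J'u' Nu'] := JJ' N u Ju Nu.
by exists u' => //; apply: (ord_le adicO) Nu'; rewrite leq_add2l.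
Qed.

Lemma approx_refl e J : approx e J J.
Proof. by move=> N u Ju _; exists u; rewrite // subrr; apply: ideal0. Qed.

(** A quantitative form of [nzd J f], supplied by [nzd_ord], that survives perturbation: cancelling
    [f] costs [c] in order. *)
Definition colon_bound J f c := forall N b,
  ideal_add J (O N) (f * b) -> ideal_add J (O (N - c)%N) b.

(** The order of the part [b'] of [b] outside [J'] is raised one unit at a time. If it is [M],
    replacing [J'] by [J] and [g] by [f] costs errors of order [M + e], which is at least
    [M + 1 + c]; the bound for [f] then puts [b'] in [J + O M.+1], and approximation leads back to
    [J']. *)
Lemma colon_bound_perturb J J' f g c e : colon_bound J f c -> (c < e)%N ->
  approx e J J' -> approx e J' J -> O e (f - g) -> colon_bound J' g c.
Proof.
move=> Jf ce JJ' J'J fg N b [j0 [t [J0 Nt E]]].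
suff : forall M, (M <= N - c)%N -> ideal_add J' (O M) b by apply.
elim=> [|M IH] lt_M.
  by exists 0, b; split; rewrite ?add0r //; [apply: ideal0 | apply: (adic0 adicO)].
have [j [b' [Jj Mb' Eb]]] := IH (ltnW lt_M).
have gb' : g * b' = (j0 - g * j) + t by rewrite addrAC -E Eb; ring.
have [j3 J3 Me3] : exists2 j3, J j3 & O (M + e)%N ((j0 - g * j) - j3).
  apply: J'J; first by apply: idealB => //; apply: idealM.
  rewrite (_ : _ - _ = g * b' - t); last by rewrite gb' addrK.
  by apply: idealB; [apply: idealM | apply: (ord_le adicO) Nt; lia].
have [j4 [w [J4 Mw Eb']]] : ideal_add J (O (M.+1 + c - c)%N) b'.
  apply: Jf; exists j3, (b' * (f - g) + ((j0 - g * j) - j3) + t); split=> //.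
    apply: idealD; first apply: idealD.
    - by apply: (ord_le adicO) (adicM adicO Mb' fg); lia.
    - by apply: (ord_le adicO) Me3; lia.
    - by apply: (ord_le adicO) Nt; lia.
  rewrite (_ : j3 + _ = b' * (f - g) + (j0 - g * j + t)); last by ring.
  by rewrite -gb'; ring.
rewrite addnK in Mw.
have [j5 J5 Me5] : exists2 j5, J' j5 & O (M + e)%N (j4 - j5).
  apply: JJ' => //; rewrite (_ : j4 = b' - w); last by rewrite Eb' addrK.
  by apply: idealB => //; apply: (ord_le adicO) Mw.
exists (j + j5), ((j4 - j5) + w); split.
- exact: idealD.
- by apply: idealD => //; apply: (ord_le adicO) Me5; lia.
- by rewrite Eb Eb'; ring.
Qed.

(** The bound lets the coefficient of [f] in [u] be replaced by some [b2] of order [N - c]; then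
    [u - b2 * f] lies in [J] and is approximated in [J'], and [b2 * f] by [b2 * g]. *)
Lemma approx_adj J J' f g c d e : colon_bound J f c -> (c + d <= e)%N ->
  approx e J J' -> O e (f - g) -> approx d (adj J f) (adj J' g).
Proof.
move=> Jf cde JJ' fg N u [b Jb] Nu.
have [b1 [b2 [Jb1 Nb2 Eb]]] : ideal_add J (O (N - c)%N) b.
  apply: Jf; exists (- (u - b * f)), u; split=> //; last by ring.
  by rewrite -mulN1r; apply: idealM.
have [j' J'j' Ne] : exists2 j', J' j' & O (N - c + e)%N (u - b2 * f - j').
  apply: JJ'.
    rewrite (_ : _ - _ = (u - b * f) + f * b1); last by rewrite Eb; ring.
    by apply: idealD => //; apply: idealM.
  by apply: idealB; [apply: (ord_le adicO) Nu; lia | rewrite mulrC; apply: idealM].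
exists (j' + b2 * g); first by exists b2; rewrite addrK.
apply: (@ord_le _ _ _ adicO _ (N - c + e)%N); first by lia.
rewrite (_ : _ - _ = (u - b2 * f - j') + b2 * (f - g)); last by ring.
by apply: idealD => //; apply: (adicM adicO).
Qed.

Lemma reg_perturb F J : reg J F -> exists E, forall e J' G, (E <= e)%N ->
  size G = size F -> (forall i, O e (F`_i - G`_i)) ->
  approx e J J' -> approx e J' J ->
  [/\ reg J' G, approx 1 (adjs J F) (adjs J' G) & approx 1 (adjs J' G) (adjs J F)].
Proof.
elim: F J => [|f F IH] J /=.
  move=> _; exists 1%N => e J' [|//] e1 _ _ JJ' J'J.
  by split=> //; apply: approx_le e1 _.
(* The first element needs [c < e] and leaves precision [e - c], of which the tail needs [E]. *)
move=> [/(nzd_ord adicO)[c cb] /IH[E EP]]; exists (c.+1 + E)%N => e J' [//|g G] le_e [sG] FG JJ' J'J.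
have fg : O e (f - g) by have := FG 0%N.
have cb' : colon_bound J' g c by apply: colon_bound_perturb cb _ JJ' J'J fg; lia.
have nzg : nzd J' g.
  (* Since [c] does not depend on [N], the colon bound and closedness of [J'] give back
     regularity. *)
  move=> u J'u; apply: (adic_closed adicO) => N.
  by rewrite -(addnK c N); apply/cb'/add_subl.
have [||||regG ap1 ap2] := EP (e - c)%N (adj J' g) G _ sG; first by lia.
- by move=> i; apply: (ord_le adicO) (FG i.+1); lia.
- by apply: approx_adj cb _ JJ' fg; lia.
- by apply: approx_adj cb' _ J'J _; [lia | rewrite -opprB -mulN1r; apply: idealM].
- by split.
Qed.

(** Elements of [O N] lie in [J], and so do the errors of their approximations in [J']; the
    approximation can be repeated, and [J'] is closed. *)
Lemma approx_mprimary J J' : approx 1 J J' -> mprimary O J -> mprimary O J'.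
Proof.
move=> JJ' [N NJ]; exists N => u Nu; apply: (adic_closed adicO) => M.
suff : ideal_add J' (O (N + M)%N) u.
  apply: add_le => v; first exact: add_subl.
  by move=> NMv; apply: add_subr; apply: (ord_le adicO) NMv; apply: leq_addl.
elim: M => [|M [v [w [J'v NMw E]]]]; first by rewrite addn0; apply: add_subr.
have [|w' J'w' NMw'] := JJ' _ w _ NMw.
  by apply: NJ; apply: (ord_le adicO) NMw; apply: leq_addr.
exists (v + w'), (w - w'); split; first exact: idealD.
  by rewrite addnS -addn1.
by rewrite E; ring.
Qed.

Lemma reldim_exists (V W : ideal A) d : codim W d -> exists e, reldim V W e.
Proof.
move=> [u us _].
pose Q e := `[< exists2 v : 'I_e -> A, forall i, V (v i) & free_mod W v >].
have Qle e : Q e -> (e <= d)%N.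
  by move=> /asboolP[v _ vf]; apply: (free_spans_le us) vf.
have Q0 : exists e, Q e by exists 0%N; apply/asboolP; exists (fun=> 0) => [[]|c _ []].
case: (ex_maxnP Q0 Qle) => e /asboolP[v vV vf] emax; exists e, v => //.
split=> // a Va.
pose v' (i : 'I_e.+1) := if unlift ord_max i is Some j then v j else a.
have v'l j : v' (lift ord_max j) = v j by rewrite /v' liftK.
have v'm : v' ord_max = a by rewrite /v' unlift_none.
have [v'f|] := pselect (free_mod W v').
  have : Q e.+1.
    apply/asboolP; by exists v' => // i; rewrite /v'; case: (unlift _ i).
  by move=> /emax; rewrite ltnn.
move=> /existsNP[c /not_implyP[]]; rewrite (bigD1_ord ord_max) //= v'm.
under eq_bigr do rewrite v'l.
move=> Wc /existsNP[i /eqP ci].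
have cm : c ord_max != 0.
  apply: contraNneq ci => cm; rewrite cm scale0r add0r in Wc.
  have c0 := vf _ Wc.
  by case: (unliftP ord_max i) => [j|] ->; rewrite ?c0 ?cm.
exists (fun j => - (c (lift ord_max j) / c ord_max)).
have := idealZ (c ord_max)^-1 Wc; congr (ideal_set W _).
rewrite scalerDr scalerA mulVf // scale1r; congr (_ + _).
rewrite scaler_sumr -sumrN; apply: eq_bigr => j _.
by rewrite scalerA scaleNr opprK mulrC.
Qed.

(** The classes modulo [O N.+1] of the [u] concerned are the initial forms of degree [N]. *)
Definition same_initial J J' := forall N u, O N u ->
  (ideal_add J (O N.+1) u <-> ideal_add J' (O N.+1) u).

Lemma approx_same_initial J J' : approx 1 J J' -> approx 1 J' J -> same_initial J J'.
Proof.
suff half I I' N u : approx 1 I I' -> O N u ->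
    ideal_add I (O N.+1) u -> ideal_add I' (O N.+1) u.
  by move=> JJ' J'J N u Nu; split; apply: half.
move=> II' Nu [i [t [Ii Nt E]]].
have Ni : O N i.
  have -> : i = u - t by rewrite E addrK.
  by apply: idealB => //; apply: (adicS adicO).
have [i' I'i' Ni'] := II' N i Ii Ni; rewrite addn1 in Ni'.
by exists i', (i - i' + t); split=> //; [apply: idealD | rewrite E; ring].
Qed.

(** A basis has representatives in [O N], where [same_initial] identifies the linear relations
    modulo the two ideals. *)
Lemma graded_reldim J J' N d : same_initial J J' ->
  reldim (ideal_add J (O N)) (ideal_add J (O N.+1)) d ->
  reldim (ideal_add J' (O N)) (ideal_add J' (O N.+1)) d.
Proof.
move=> JJ' [u [uV us] uf].
have /choice[u' u'P] : forall i, exists u', O N u' /\ J (u i - u').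
  by move=> i; have [j [t [Jj Nt ->]]] := uV i; exists t; rewrite addrK.
have Jsum c : J (\sum_i c i *: u i - \sum_i c i *: u' i).
  rewrite -sumrB; apply: ideal_sum => i _; rewrite -scalerBr; apply: idealZ.
  by have [] := u'P i.
have Nsum c : O N (\sum_i c i *: u' i).
  by apply: ideal_sum => i _; apply: idealZ; have [] := u'P i.
exists u'; first split=> [i|a [j [t [J'j Nt ->]]]].
- by apply: add_subr; have [] := u'P i.
- have [c Wc] := us t (add_subr J Nt); exists c.
  rewrite -addrA; apply: idealD; first exact: add_subl.
  apply/JJ'; first exact: idealB.
  rewrite (_ : t - _ = (t - \sum_i c i *: u i) +
    (\sum_i c i *: u i - \sum_i c i *: u' i)); last by rewrite addrA subrK.
  by apply: idealD => //; apply: add_subl.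
- move=> c /JJ' -/(_ (Nsum c)) Wc; apply: uf.
  by rewrite -(subrK (\sum_i c i *: u' i) (\sum_i _)); apply: idealD => //; apply: add_subl.
Qed.

Lemma codim_same_initial J J' N d : same_initial J J' ->
  codim (ideal_add J (O N)) d -> codim (ideal_add J' (O N)) d.
Proof.
move=> JJ'; elim: N d => [|N IH] d Jd.
  suff -> : ideal_add J' (O 0%N) = ideal_add J (O 0%N) by [].
  by apply: ideal_ext => u; split=> _; apply/add_subr/(adic0 adicO).
have sub I u : ideal_add I (O N.+1) u -> ideal_add I (O N) u.
  by apply: add_le => v; [apply: add_subl | move=> /(adicS adicO); apply: add_subr].
have [e eP] := reldim_exists (ideal_add J (O N)) Jd.
have Je := hdimP adicO J N.
have topV V (u : A) : ideal_set V u -> top_ideal A u by [].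
rewrite (reldim_unique Jd (reldim_trans (topV _) (@sub J) Je eP)).
exact: reldim_trans (topV _) (@sub J') (IH _ Je) (graded_reldim JJ' eP).
Qed.

End Perturbation.

(** * Quotient rings *)

Section PrimeChains.
Variable A : comPzRingType.
Implicit Types (J P Q : ideal A).

Definition strict_chain d (P : 'I_d.+1 -> ideal A) := forall i j : 'I_d.+1, (i < j)%N ->
  ideal_set (P i) `<` ideal_set (P j).

Lemma strict_chain_above d (P : 'I_d.+1 -> ideal A) J :
  (forall i, prime_ideal (P i)) -> strict_chain P -> (forall u, J u -> P ord0 u) ->
  prime_chain_above d J.
Proof.
elim: d P J => [|d IH] P J Pp Plt JP; exists (P ord0); split=> //.
have [le0 nle0] := Plt ord0 (lift ord0 ord0) isT.
exists (P (lift ord0 ord0)); split=> //.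
  by apply: contrapT => nu; apply: nle0 => u Pu; apply: contrapT => nPu; apply: nu; exists u.
by apply: (IH (fun i => P (lift ord0 i))) => // i j ij; apply: Plt.
Qed.

Lemma chain_above_strict d J : prime_chain_above d J -> exists P : 'I_d.+1 -> ideal A,
  [/\ forall i, prime_ideal (P i), strict_chain P & forall i u, J u -> P i u].
Proof.
elim: d J => [|d IH] J [P [Pp JP]].
  by move=> _; exists (fun=> P); split=> // i j; rewrite !ord1.
move=> [J' [PJ' [z J'z nPz] /IH[Q [Qp Qlt J'Q]]]].
exists (fun i => if unlift ord0 i is Some j then Q j else P); split.
- by move=> i; case: (unlift ord0 i).
- move=> i j; case: (unliftP ord0 i) => [i'|] ->; case: (unliftP ord0 j) => [j'|] -> //.
    by move=> ij; apply: Qlt.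
  by move=> _; split=> [u /PJ'/J'Q//|QP]; apply/nPz/QP/J'Q.
- by move=> i u /JP Pu; case: (unlift ord0 i) => // j; apply/J'Q/PJ'.
Qed.

Section Quotient.
Variable J : ideal A.
Implicit Types (p : ideal (quot_ring J)) (x y : quot_ring J).

Lemma quot_pi_eq0 u : \pi_(quot_ring J) u = 0 <-> J u.
Proof.
have -> : (0 : quot_ring J) = \pi_(quot_ring J) 0 by rewrite piE.
split=> [/eqP/quot_eqP|Ju]; first by rewrite subr0.
by apply/eqP/quot_eqP; rewrite subr0.
Qed.

Section Comap.
Variable p : ideal (quot_ring J).
Definition comap_set : set A := [set u | p (\pi_(quot_ring J) u)].

Lemma comap_set0 : comap_set 0.
Proof. by rewrite /comap_set /= (quot_pi_eq0 0).2; apply: ideal0. Qed.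

Lemma comap_setD u v : comap_set u -> comap_set v -> comap_set (u + v).
Proof. by move=> pu pv; rewrite /comap_set /= quot_piD; apply: idealD. Qed.

Lemma comap_setM a u : comap_set u -> comap_set (a * u).
Proof. by move=> pu; rewrite /comap_set /= quot_piM; apply: idealM. Qed.

Definition comap_ideal : ideal A := Ideal comap_set0 comap_setD comap_setM.

Lemma comap_prime : prime_ideal p -> prime_ideal comap_ideal.
Proof.
move=> [p1 pp]; split=> // u v.
by rewrite /= /comap_set /= quot_piM => /pp.
Qed.

End Comap.

Section Push.
Variable P : ideal A.
Hypothesis JP : forall u, J u -> P u.

Lemma repr_pi_mem u : P (repr (\pi_(quot_ring J) u)) <-> P u.
Proof.
have Pd : P (repr (\pi_(quot_ring J) u) - u).
  by apply/JP/quot_eqP; rewrite reprK.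
split=> Pu; last by rewrite -(subrK u (repr _)); apply: idealD.
rewrite (_ : u = repr (\pi_(quot_ring J) u) - (repr (\pi_(quot_ring J) u) - u)).
  exact: idealB.
by rewrite opprB addrC subrK.
Qed.

Definition push_set : set (quot_ring J) := [set x | P (repr x)].

Lemma push_set0 : push_set 0.
Proof. by rewrite /push_set /= -((quot_pi_eq0 0).2 (ideal0 J)); apply/repr_pi_mem/ideal0. Qed.

Lemma push_setD x y : push_set x -> push_set y -> push_set (x + y).
Proof.
move=> Px Py; rewrite /push_set /= -[x]reprK -[y]reprK -quot_piD.
by apply/repr_pi_mem/idealD.
Qed.

Lemma push_setM x y : push_set y -> push_set (x * y).
Proof. by move=> Py; apply/repr_pi_mem/idealM. Qed.

Definition push_ideal : ideal (quot_ring J) := Ideal push_set0 push_setD push_setM.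

Lemma push_prime : prime_ideal P -> prime_ideal push_ideal.
Proof.
move=> [P1 Pp]; split; first by move/repr_pi_mem.
by move=> x y /repr_pi_mem/Pp.
Qed.

End Push.

(** The correspondence between primes of the quotient and primes over [J], by preimage and image. *)
Lemma quot_prime_chain d : has_prime_chain (quot_ring J) d <-> prime_chain_above d J.
Proof.
split=> [[p [pp plt]]|/chain_above_strict[P [Pp Plt JP]]].
  apply: (@strict_chain_above _ (fun i => comap_ideal (p i))).
  - by move=> i; apply: comap_prime.
  - move=> i j /plt[le nle]; split=> [u|le']; first exact: le.
    by apply: nle => x; rewrite -[x]reprK; apply: le'.
  - by move=> u /quot_pi_eq0; rewrite /= /comap_set /= => ->; apply: ideal0.
exists (fun i => push_ideal (JP i)); split=> [i|i j /Plt[le nle]]; first exact: push_prime.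
split=> [x|le']; first exact: le.
apply: nle => u Pu; apply/(repr_pi_mem (JP i)).
by apply: (le' (\pi_(quot_ring J) u)); apply/(repr_pi_mem (JP j)).
Qed.

End Quotient.

End PrimeChains.

Section QuotientDimension.
Variables (K : fieldType).

Lemma linear_bij_inv (V W : lmodType K) (f : {linear V -> W}) : bijective f ->
  exists g : {linear W -> V}, bijective g.
Proof.
move=> [g fK gK]; have lin : linear g.
  by move=> a x y; apply: (can_inj fK); rewrite linearP !gK.
pose gL : {linear W -> V} := HB.pack g (GRing.isLinear.Build _ _ _ _ g lin).
by exists gL; exists f.
Qed.

End QuotientDimension.

Lemma has_dim_quot (K : numFieldType) (A : comAlgType K) (J : ideal A) d :
  has_dim (quot_ring J : lmodType K) d <-> codim J d.
Proof.
pose pi u := \pi_(quot_ring J) u.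
have piB u v : pi (u - v) = pi u - pi v by rewrite /pi !piE.
have piZ (c : K) u : pi (c *: u) = c *: pi u by apply: quot_piZ.
have pi_sum m (c : 'I_m -> K) u : pi (\sum_i c i *: u i) = \sum_i c i *: pi (u i).
  rewrite (big_morph pi (quot_piD J) (_ : pi 0 = 0)).
    by apply: eq_bigr => i _; apply: piZ.
  exact/quot_pi_eq0/ideal0.
split=> [[f [g fK gK]]|[u [_ us] uf]].
  have ug i : pi (repr (g (delta_mx 0 i))) = g (delta_mx 0 i) by apply: reprK.
  have f_sum (c : 'I_d -> K) :
      f (\sum_i c i *: pi (repr (g (delta_mx 0 i)))) = \row_i c i.
    rewrite linear_sum [RHS]row_sum_delta; apply: eq_bigr => i _.
    by rewrite linearZ /= ug gK mxE.
  exists (fun i => repr (g (delta_mx 0 i))).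
    split=> // a _; exists (fun i => f (pi a) 0 i).
    apply/quot_pi_eq0; rewrite -/(pi _) piB pi_sum; apply: (can_inj fK).
    rewrite linearB linear0 f_sum; apply/eqP; rewrite subr_eq0; apply/eqP/rowP => i.
    by rewrite mxE.
  move=> c /quot_pi_eq0; rewrite -/(pi _) pi_sum => /(congr1 f).
  by rewrite f_sum linear0 => /rowP c0 i; have := c0 i; rewrite !mxE.
pose h (x : 'rV[K]_d) := \sum_i x 0 i *: pi (u i).
have lin : linear h.
  move=> a x y; rewrite /h scaler_sumr -big_split; apply: eq_bigr => i _.
  by rewrite !mxE scalerDl scalerA.
pose hL : {linear 'rV[K]_d -> quot_ring J} := HB.pack h (GRing.isLinear.Build _ _ _ _ h lin).
apply: (@linear_bij_inv _ _ _ hL).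
have /choice[g gP] : forall x : quot_ring J, exists y, h y = x.
  move=> x; have [c Jc] := us (repr x) I; exists (\row_i c i).
  apply/eqP; rewrite eq_sym -subr_eq0 -[x]reprK; apply/eqP.
  move/quot_pi_eq0: Jc; rewrite -/(pi _) piB pi_sum /h => E; rewrite -[RHS]E /pi.
  by congr (_ - _); apply: eq_bigr => i _; rewrite mxE.
exists g => [x|]; last exact: gP.
apply/rowP => i; apply/eqP; rewrite -subr_eq0; apply/eqP.
apply: (uf (fun i => g (h x) 0 i - x 0 i)); apply/quot_pi_eq0.
rewrite -/(pi _) pi_sum; under eq_bigr do rewrite scalerBl.
by rewrite sumrB -/(h _) -/(h _) gP subrr.
Qed.

(** * The coordinates as a regular sequence *)

Lemma span_codom (A : comPzRingType) (k : nat) (F : 'I_k -> A) :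
  ideal_span (range F) = adjs (ideal_span set0) (codom F).
Proof.
have sub0 J u : ideal_span (set0 : set A) u -> ideal_set J u.
  by move=> [r [a [s [sS ->]]]]; apply: ideal_sum => i _; case: (sS i).
apply: ideal_ext => u; split.
  move=> [r [a [s [sS ->]]]]; apply: ideal_sum => i _; apply: idealM.
  by have [j _ <-] := sS i; apply/mem_adjs/codom_f.
apply: adjs_le => [v|z]; first exact: sub0.
move=> /codomP[i ->]; exists 1%N, (fun=> 1), (fun=> F i); split; first by move=> j; exists i.
by rewrite big_ord1 mul1r.
Qed.

Lemma ideal_pow_ord (K : numFieldType) (A : comAlgType K) (O : nat -> ideal A) N :
  adic_filtration O -> ideal_pow (O 1%N) N = O N.
Proof.
move=> adicO; apply: ideal_ext => u; split.
  move=> [r [a [s [sS ->]]]]; apply: ideal_sum => i _; apply: idealM.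
  have [t [t1 ->]] := sS i; elim: N {sS} t t1 => [|N IH] t t1.
    by rewrite big_ord0; apply: adic0.
  rewrite big_ord_recl; apply: (adicM adicO (M := 1%N)) => //.
  by apply: IH => j; apply: t1.
elim: N u => [|N IH] u.
  move=> _; exists 1%N, (fun=> u), (fun=> 1); split; last by rewrite big_ord1 mulr1.
  by move=> _; exists (fun=> 0); split=> [[]//|]; rewrite big_ord0.
rewrite -add1n; apply: (adic_prod adicO) => {u} x v x1 /IH[r [a [s [sS ->]]]].
rewrite mulr_sumr; apply: ideal_sum => i _; rewrite mulrCA; apply: idealM.
exists 1%N, (fun=> 1), (fun=> x * s i); split; last by rewrite big_ord1 mul1r.
move=> _; have [t [t1 ->]] := sS i.
exists (fun j => if unlift ord0 j is Some l then t l else x); split.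
  by move=> j; case: (unlift ord0 j).
rewrite big_ord_recl unlift_none; congr (_ * _).
by apply: eq_bigr => j _; rewrite liftK.
Qed.

Section Variables.
Variables (n : nat) (K : numFieldType).
Local Notation zero := (ideal_span (set0 : set (cps n K))).

Definition var (i : 'I_n) : cps n K := monomial K U_(i)%MM.

Lemma var_ord1 i : cps_ord 1 (var i).
Proof. by rewrite -(mdeg1 i); apply: monomial_ord. Qed.

(** From right to left, the claim is clear for monomials, hence for truncations, and passes to the
    limit by [cps_ord_closed]. *)
Lemma adjs_var (r : seq 'I_n) u : adjs zero (map var r) u <->
  forall a : 'X_{1..n}, (forall i, i \in r -> a i = 0%N) -> cps_val u a = 0.
Proof.
pose V : set (cps n K) :=
  [set u | forall a : 'X_{1..n}, (forall i, i \in r -> a i = 0%N) -> cps_val u a = 0].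
have V0 : V 0 by [].
have VD f g : V f -> V g -> V (f + g) by move=> Vf Vg a ar; rewrite cpsD Vf ?Vg ?addr0.
have VM f g : V g -> V (f * g).
  move=> Vg a ar; rewrite cps_valM (fps_mul_single _ _ (ltnSn (mdeg a))) big1 // => c _.
  by rewrite Vg ?mulr0 // => i /ar; rewrite mnmBE => ->.
split.
  apply: (adjs_le (I := Ideal V0 VD VM)) => [v [m [a [s [sS ->]]]]|_ /mapP[i ir ->] a ar].
    by apply: ideal_sum => i _; case: (sS i).
  rewrite monomialE; case: eqP => // E; have := ar i ir.
  by rewrite E mnm1E eqxx.
move=> Vu; apply: cps_ord_closed => D.
exists (truncation D u), (u - truncation D u).
split; [|exact: truncation_ord|by rewrite addrC subrK].
apply: ideal_sum => a _.
have [ar|] := pselect (forall i, i \in r -> bmnm a i = 0%N).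
  by rewrite Vu // scale0r; apply: ideal0.
move=> /existsNP[i /not_implyP[ir /eqP ai]]; apply: idealZ.
have Ua : (U_(i) <= bmnm a)%MM by rewrite lep1mP.
rewrite -(submK Ua) monomialM; apply: idealM; apply: mem_adjs.
exact: map_f.
Qed.

Lemma reg_var (s r : seq 'I_n) : uniq (r ++ s) ->
  reg (adjs zero (map var r)) (map var s).
Proof.
elim: s r => [|i s IH] r //= urs; split; last first.
  have -> : adj (adjs zero (map var r)) (var i) = adjs zero (map var (rcons r i)).
    by rewrite map_rcons -cats1 adjs_cat.
  by apply: IH; rewrite cat_rcons.
have ir : i \notin r.
  by move: urs; rewrite cat_uniq => /and3P[_ /hasPn/(_ i) + _]; rewrite mem_head; apply.
move=> u /adjs_var Vu; apply/adjs_var => a ar.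
have := Vu (U_(i) + a)%MM; rewrite mul_monomialE lem_addr addmC addmK; apply.
by move=> j jr; rewrite mnmDE ar // mnm1E; case: eqP jr ir => [->->|].
Qed.

Definition vars : seq (cps n K) := map var (enum 'I_n).

Lemma size_vars : size vars = n.
Proof. by rewrite size_map size_enum_ord. Qed.

Lemma vars_ord1 z : z \in vars -> cps_ord 1 z.
Proof. by move=> /mapP[i _ ->]; apply: var_ord1. Qed.

Lemma vars_reg : reg zero vars.
Proof. by apply: (@reg_var _ [::]); rewrite enum_uniq. Qed.

Lemma vars_mprimary : mprimary (@cps_ord n K) (adjs zero vars).
Proof.
exists 1%N => u u1; apply/adjs_var => a ar; apply: u1.
rewrite ltnS leqn0 mdeg_eq0; apply/eqP/mnmP => i.
by rewrite mnm0E ar // mem_enum.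
Qed.

End Variables.

(** * From the order filtration to the ideals [(F)] and [(G)] *)

Lemma cps_maximal_ord n (K : numFieldType) : cps_maximal n K = cps_ord 1.
Proof.
apply: ideal_ext => u; split=> [u0 a|u1]; last by apply: u1; rewrite mdeg0.
by rewrite ltnS leqn0 mdeg_eq0 => /eqP->.
Qed.

Lemma adjs_proper (K : numFieldType) (A : comAlgType K) (O : nat -> ideal A)
    (s : seq A) : adic_filtration O -> (forall z, z \in s -> O 1%N z) ->
  ~ adjs (ideal_span set0) s 1.
Proof.
move=> adicO s1 H; apply: (adic_proper adicO); move: H.
apply: adjs_le => // u [m [a [t [tS ->]]]].
by apply: ideal_sum => i _; case: (tS i).
Qed.

Lemma nth_codom_ord (T : Type) (x : T) k (F : 'I_k -> T) i (lt_i : (i < k)%N) :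
  nth x (codom F) i = F (Ordinal lt_i).
Proof.
rewrite (nth_map (Ordinal lt_i)) ?size_enum_ord //; congr F.
by apply: val_inj; rewrite /= nth_enum_ord.
Qed.

(** The default value of [nth] pads the generators with zeros. *)
Lemma generated_by_le (A : comPzRingType) k m (G : 'I_k -> A) : (k <= m)%N ->
  generated_by (ideal_span (range G)) m.
Proof.
move=> km; exists (fun i : 'I_m => (codom G)`_i); congr ideal_set.
rewrite !span_codom; apply: ideal_ext => u; split; apply: adjs_le => [v|z].
- exact: sub_adjs.
- move=> /codomP[i ->]; apply/mem_adjs/codomP.
  have lt_i : (widen_ord km i < k)%N := ltn_ord i.
  by exists (widen_ord km i); rewrite (nth_codom_ord _ _ lt_i); congr G; apply: val_inj.
- exact: sub_adjs.
- move=> /codomP[i ->]; have [lt_i|le_i] := ltnP i k.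
    by rewrite (nth_codom_ord _ _ lt_i); apply/mem_adjs/codom_f.
  by rewrite nth_default ?size_codom ?card_ord //; apply: ideal0.
Qed.

Theorem theorem7p3 (R : realType) (K : numFieldType)
    (hK : K = (R : numFieldType) \/ K = (R[i] : numFieldType))
    (n k : nat) (hkn : (k <= n)%N) (F : 'I_k -> cps n K)
    (hci : complete_intersection (ideal_span (range F)))
    (hdim : krull_dim_is (quot_ring (ideal_span (range F))) (n - k)) :
  exists mu0 : nat, forall mu : nat, (mu0 <= mu)%N ->
    forall G : 'I_k -> cps n K,
      (forall i : 'I_k, jet mu (G i) = jet mu (F i)) ->
      complete_intersection (ideal_span (range G)) /\
      hilbert_samuel (ideal_span (range G)) =
        hilbert_samuel (ideal_span (range F)).
Proof.
have adicO := cps_adic n K; set O := @cps_ord n K in adicO.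
pose Z : ideal (cps n K) := ideal_span set0.
have powO N : ideal_pow (cps_maximal n K) N = O N.
  by rewrite cps_maximal_ord ideal_pow_ord.
have [dF dF_le] := hdim.
have F1 z : z \in codom F -> O 1%N z.
  move=> zF; apply: (local_sub adicO (J := ideal_span (range F))).
    by apply: (prime_chain_above_proper (d := n - k)); apply/quot_prime_chain.
  by rewrite span_codom; apply: mem_adjs.
have [|y [ysize y1 yF]] := @exists_parameters _ _ _ adicO (n - k) (adjs Z (codom F)).
  by move=> d; rewrite -span_codom => /quot_prime_chain/dF_le.
have sizeF : size (codom F) = k by rewrite size_codom card_ord.
have cat1 s : (forall z, z \in s -> O 1%N z) -> forall z, z \in s ++ y -> O 1%N z.
  by move=> s1 z; rewrite mem_cat => /orP[/s1|/y1].
(* [F] and [y] together are [n] parameters, as many as the variables, whose regularity is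
   transferred to them. *)
have regFy : reg Z (codom F ++ y).
  apply: (parameters_reg adicO _ _ _ (vars_reg n K)); rewrite ?adjs_cat //.
  - by rewrite size_vars size_cat sizeF ysize subnKC.
  - exact: vars_ord1.
  - exact: cat1.
  - exact: vars_mprimary.
(* Perturbing [F] alone compares the initial forms of the two ideals; perturbing [F] followed by [y]
   controls the dimension. *)
have [EF EFP] := reg_perturb adicO ((reg_cat _ _ _).1 regFy).1.
have [E EP] := reg_perturb adicO regFy.
exists (maxn EF E) => mu le_mu G jetG.
(* Equality of [mu]-jets is congruence modulo [m^(mu + 1)], hence the precision [mu.+1]. *)
have FG i : O mu.+1 (F i - G i).
  rewrite -powO; apply/quot_eqP; rewrite eq_sym; apply/eqP; exact: jetG.
have FGs i : O mu.+1 ((codom F)`_i - (codom G)`_i).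
  have [lt_i|le_i] := ltnP i k; last first.
    by rewrite !nth_default ?size_codom ?card_ord // subr0; apply: ideal0.
  by rewrite !(nth_codom_ord _ _ lt_i); apply: FG.
have FGy i : O mu.+1 ((codom F ++ y)`_i - (codom G ++ y)`_i).
  rewrite !nth_cat !size_codom; case: ifP => // _.
  by rewrite subrr; apply: ideal0.
have sizeG : size (codom G) = k by rewrite size_codom card_ord.
have [|||||_ apFG apGF] := EFP mu.+1 Z (codom G).
- by rewrite (leq_trans (leq_maxl _ _) (leqW le_mu)).
- by rewrite sizeG sizeF.
- exact: FGs.
- exact: approx_refl.
- exact: approx_refl.
have [|||||regGy apFGy apGFy] := EP mu.+1 Z (codom G ++ y).
- by rewrite (leq_trans (leq_maxr _ _) (leqW le_mu)).
- by rewrite !size_cat sizeG sizeF.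
- exact: FGy.
- exact: approx_refl.
- exact: approx_refl.
have same : same_initial O (adjs Z (codom F)) (adjs Z (codom G)).
  exact: approx_same_initial.
split; last first.
  apply: funext => eta; rewrite /hilbert_samuel /vdim; congr xget.
  apply: funext => d; apply/propext; rewrite powO !span_codom /= !has_dim_quot.
  by split; apply: (codim_same_initial adicO) => // N u Nu; split=> /(same N u Nu).
have G1 z : z \in codom G -> O 1%N z.
  move=> /codomP[i ->]; rewrite -[G i](subKr (F i)); apply: idealB.
    exact/F1/codom_f.
  exact: (ord_le adicO) (FG i).
have [dA [_ [dimA _ _]]] := hci.
(* The variables give a chain of length [n], so [dA - (n - k)] is at least [k] and the [G i] can be
   padded to that number of generators. *)
have n_dA : (n <= dA)%N.
  apply: dimA.2; rewrite -{2}(size_vars n K).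
  have := prime_chain_reg adicO (@vars_ord1 n K) (vars_reg n K)
    (adjs_proper (s := [::]) adicO _).
  rewrite colon1 => /(_ (fun=> _))/chain_above_strict[//|P [Pp Plt _]].
  by exists P.
exists dA, (n - k)%N; split=> //; last by apply: generated_by_le; lia.
rewrite /krull_dim_is; split.
  (* The sequence [y] is regular modulo the proper ideal [(G)] and yields a chain of length
     [n - k]. *)
  apply/quot_prime_chain; rewrite span_codom -ysize -[adjs _ _]colon1.
  apply: (prime_chain_reg adicO y1); first by have /reg_cat[] := regGy.
  exact: adjs_proper adicO G1.
(* Adjoining [y] to [(G)] gives an ideal containing some [O N], so no chain is longer than [y]. *)
move=> e /quot_prime_chain; rewrite span_codom -ysize.
apply: (mprimary_dim_le adicO y1); rewrite -adjs_cat.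
by apply: (approx_mprimary adicO apFGy); rewrite adjs_cat.
Qed.
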